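(* Let $(\mathcal C,\mathsf d_{\mathcal C})$ be the cone, with apex $\boldsymbol0$, over a geodesic metric space $(\mathcal X,\mathsf d_{\mathcal X})$, and let $m\in\mathbb N$. (a) If $(\mathcal C,\mathsf d_{\mathcal C})$ satisfies $m$-LAC, then $(\mathcal X,\mathsf d_{\mathcal X})$ does too. (b) Conversely, if $(\mathcal X,\mathsf d_{\mathcal X})$ satisfies $m$-LAC, then $(\mathcal C,\mathsf d_{\mathcal C})$ satisfies it at every point of $\mathcal C\setminus\{\boldsymbol0\}$. (c) $(\mathcal C,\mathsf d_{\mathcal C})$ satisfies $3$-LAC if and only if $(\mathcal X,\mathsf d_{\mathcal X})$ satisfies $3$-LAC and has perimeter less than or equal to $2\pi$. (d) If $(\mathcal X,\mathsf d_{\mathcal X})$ has diameter less than or equal to $\pi/2$ and satisfies $m$-LAC for some $m$, then $(\mathcal C,\mathsf d_{\mathcal C})$ satisfies $m$-LAC.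
   Context: The cone $\mathcal C$ over $(\mathcal X,\mathsf d_{\mathcal X})$ is the quotient of $\mathcal X\times[0,\infty)$ obtained by identifying all points of $\mathcal X\times\{0\}$ with one point $\boldsymbol 0$ (the apex); $[x,r]$ is the class of $(x,r)$, and $\mathsf d_{\mathcal C}^2([x_0,r_0],[x_1,r_1])=r_0^2+r_1^2-2r_0r_1\cos(\min\{\pi,\mathsf d_{\mathcal X}(x_0,x_1)\})$. For two (constant-speed, non-trivial) geodesics $\boldsymbol y_{01},\boldsymbol y_{02}$ in a metric space $(Y,\mathsf d)$ emanating from the same point $y_0$, the upper angle $\angle_{\mathrm{up}}(\boldsymbol y_{01},\boldsymbol y_{02})\in[0,\pi]$ is $$\angle_{\mathrm{up}}(\boldsymbol y_{01},\boldsymbol y_{02})=\limsup_{s,t\downarrow0}\arccos\frac{\mathsf d^2(y_0,\boldsymbol y_{01}(s))+\mathsf d^2(y_0,\boldsymbol y_{02}(t))-\mathsf d^2(\boldsymbol y_{01}(s),\boldsymbol y_{02}(t))}{2\,\mathsf d(y_0,\boldsymbol y_{01}(s))\,\mathsf d(y_0,\boldsymbol y_{02}(t))}.$$ $(Y,\mathsf d)$ satisfies $m$-LAC (local angle condition) at $y_0$ if for every choice of $m$ non-trivial geodesics $\boldsymbol y_{0i}$ starting at $y_0$ and positive reals $b_i$, $i=1,\dots,m$, one has $\sum_{i,j=1}^mb_ib_j\cos(\angle_{\mathrm{up}}(\boldsymbol y_{0i},\boldsymbol y_{0j}))\ge0$; it satisfies $m$-LAC if it does so at all its points. ''Perimeter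 less than or equal to $2\pi$'' means that $\mathsf d_{\mathcal X}(x_1,x_2)+\mathsf d_{\mathcal X}(x_2,x_3)+\mathsf d_{\mathcal X}(x_3,x_1)\le2\pi$ for all pairwise different $x_1,x_2,x_3\in\mathcal X$. *)

(* Defs.v *)
From HB Require Import structures.
From mathcomp Require Import all_boot all_order all_algebra generic_quotient.
From mathcomp Require Import all_classical all_reals all_analysis.
From mathcomp Require Import ring lra.
Set Implicit Arguments.
Unset Strict Implicit.
Unset Printing Implicit Defensive.
Import Order.TTheory GRing.Theory Num.Theory.
Import numFieldNormedType.Exports.
Local Open Scope quotient_scope.
Local Open Scope classical_set_scope.
Local Open Scope ring_scope.

Section Metric.
Context {R : realType} {Y : metricType R}.

(* Constant-speed minimal geodesics parametrized on [0, 1]; the values of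
   [y] outside [0, 1] are junk. *)
Definition is_geodesic (y : R -> Y) : Prop :=
  forall s t : R, 0 <= s <= 1 -> 0 <= t <= 1 ->
    mdist (y s) (y t) = `|s - t| * mdist (y 0) (y 1).

Definition nontrivial_geodesic_from (y0 : Y) (y : R -> Y) : Prop :=
  [/\ is_geodesic y, y 0 = y0 & y 0 != y 1].

Definition comparison_angle (a b c : Y) : R :=
  acos ((mdist a b ^+ 2 + mdist a c ^+ 2 - mdist b c ^+ 2)
        / (2 * mdist a b * mdist a c)).

(* The limsup is taken in the extended reals; for non-trivial geodesics it
   lies in [0, pi], so that [fine] loses nothing. *)
Definition upper_angle (y0 : Y) (y1 y2 : R -> Y) : R :=
  fine (limf_esup (fun st : R * R =>
                     (comparison_angle y0 (y1 st.1) (y2 st.2))%:E)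
                  (filter_prod (0 : R)^'+ (0 : R)^'+)).

Definition LAC_at (m : nat) (y0 : Y) : Prop :=
  forall (y : 'I_m -> R -> Y) (b : 'I_m -> R),
    (forall i, nontrivial_geodesic_from y0 (y i)) ->
    (forall i, 0 < b i) ->
    0 <= \sum_(i < m) \sum_(j < m)
           b i * b j * cos (upper_angle y0 (y i) (y j)).

End Metric.

Definition LAC {R : realType} (m : nat) (Y : metricType R) : Prop :=
  forall y0 : Y, LAC_at m y0.

Definition geodesic_space {R : realType} (X : metricType R) : Prop :=
  forall x0 x1 : X, exists y : R -> X, [/\ is_geodesic y, y 0 = x0 & y 1 = x1].

Definition perimeter_le_2pi {R : realType} (X : metricType R) : Prop :=
  forall x1 x2 x3 : X, x1 != x2 -> x2 != x3 -> x3 != x1 ->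
    mdist x1 x2 + mdist x2 x3 + mdist x3 x1 <= 2 * pi.

Definition diameter {R : realType} (X : metricType R) : \bar R :=
  ereal_sup [set (mdist p.1 p.2)%:E | p in [set: X * X]].

Section ConeType.
Context {R : realType} (X : metricType R).

Definition cone_rel (p q : X * {nonneg R}) : bool :=
  (p.2%:num == 0) && (q.2%:num == 0) || (p == q).

Lemma cone_rel_refl : reflexive cone_rel.
Proof. by move=> p; rewrite /cone_rel eqxx orbT. Qed.

Lemma cone_rel_sym : symmetric cone_rel.
Proof. by move=> p q; rewrite /cone_rel andbC (eq_sym p). Qed.

Lemma cone_rel_trans : transitive cone_rel.
Proof.
move=> q p r; rewrite /cone_rel.
case/orP=> [/andP[p0 q0]|/eqP->//].
by case/orP=> [/andP[_ r0]|/eqP<-]; apply/orP; left; apply/andP.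
Qed.

Canonical cone_equiv := EquivRel cone_rel cone_rel_refl cone_rel_sym
  cone_rel_trans.

Definition cone : Type := {eq_quot cone_equiv}.
HB.instance Definition _ := Choice.on cone.
HB.instance Definition _ := EqQuotient.on cone.

Definition cone_pt (x : X) (r : {nonneg R}) : cone := \pi_cone (x, r).

(* A set, so that no point of the base has to be chosen; it is a singleton
   as soon as the base is nonempty, see [apexE]. *)
Definition apex : set cone := [set p | exists x, p = cone_pt x 0%:nng].

Lemma apexE (x : X) : apex = [set cone_pt x 0%:nng].
Proof.
apply/seteqP; split => [p [y ->]|p ->]; last by exists x.
by apply/eqP; rewrite /cone_pt piE /= /cone_rel /= eqxx.
Qed.

Definition pre_cone_dist (p q : X * {nonneg R}) : R :=
  Num.sqrt (p.2%:num ^+ 2 + q.2%:num ^+ 2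
            - 2 * p.2%:num * q.2%:num * cos (Num.min pi (mdist p.1 q.1))).

Definition cone_dist : cone -> cone -> R := lift_fun2 cone pre_cone_dist.

Lemma pre_cone_distC p q : pre_cone_dist p q = pre_cone_dist q p.
Proof. by rewrite /pre_cone_dist metric_sym; congr Num.sqrt; ring. Qed.

Lemma pre_cone_dist_rel p p' q : cone_rel p p' ->
  pre_cone_dist p q = pre_cone_dist p' q.
Proof.
case/orP=> [/andP[/eqP p0 /eqP p'0]|/eqP->//].
by rewrite /pre_cone_dist p0 p'0 !(mulr0, mul0r).
Qed.

Lemma pi_cone_dist : {mono \pi_cone : p q / pre_cone_dist p q >-> cone_dist p q}.
Proof.
move=> p q; unlock cone_dist.
rewrite (@pre_cone_dist_rel _ p); last first.
  by have /eqP := reprK (\pi_cone p); rewrite piE.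
rewrite pre_cone_distC (@pre_cone_dist_rel _ q) 1?pre_cone_distC//.
by have /eqP := reprK (\pi_cone q); rewrite piE.
Qed.

Canonical cone_dist_mono2 := PiMono2 pi_cone_dist.

Lemma cone_distE (x0 x1 : X) (r0 r1 : {nonneg R}) :
  cone_dist (cone_pt x0 r0) (cone_pt x1 r1) ^+ 2 =
  r0%:num ^+ 2 + r1%:num ^+ 2
  - 2 * r0%:num * r1%:num * cos (Num.min pi (mdist x0 x1)).
Proof.
rewrite /cone_pt piE /pre_cone_dist /= sqr_sqrtr//.
set c := cos _; have c1 : c <= 1 by exact: cos_le1.
have -> : r0%:num ^+ 2 + r1%:num ^+ 2 - 2 * r0%:num * r1%:num * c =
    (r0%:num - r1%:num) ^+ 2 + 2 * (r0%:num * r1%:num * (1 - c)) by ring.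
by rewrite addr_ge0 ?sqr_ge0// !mulr_ge0// subr_ge0.
Qed.

Lemma cone_distxx p : cone_dist p p = 0.
Proof.
elim/quotP: p => -[x r] _; rewrite piE /pre_cone_dist /= mdistxx.
rewrite min_r ?pi_ge0// cos0; rewrite [X in Num.sqrt X](_ : _ = 0) ?sqrtr0//; ring.
Qed.

Lemma cone_dist_sym p q : cone_dist p q = cone_dist q p.
Proof.
elim/quotP: p => p _; elim/quotP: q => q _.
by rewrite !piE pre_cone_distC.
Qed.

Lemma cone_dist_eq0 p q : cone_dist p q = 0 -> p = q.
Proof.
elim/quotP: p => -[x r] _; elim/quotP: q => -[y s] _ d0.
have := cone_distE x y r s; rewrite /cone_pt d0 expr0n /=.
set m := Num.min _ _; have := cos_le1 m => c1 e.
have r0 : 0 <= r%:num by [].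
have s0 : 0 <= s%:num by [].
have c1' : 0 <= 1 - cos m by rewrite subr_ge0.
have {}e : (r%:num - s%:num) ^+ 2 + 2 * (r%:num * s%:num * (1 - cos m)) = 0.
  by apply: etrans (esym e); ring.
move/eqP: e; rewrite paddr_eq0 ?sqr_ge0 ?mulr_ge0// sqrf_eq0 subr_eq0.
case/andP=> /eqP rs; rewrite -rs !mulf_eq0 pnatr_eq0 orbb /= => rc.
apply/eqP; rewrite piE /= /cone_rel /= -rs andbb.
case/orP: rc => [->//|]; rewrite subr_eq0 => /eqP/esym {}c1.
have m0 : m = 0.
  apply: cos_inj; rewrite ?cos0// in_itv /= ?lexx ?pi_ge0//.
  by rewrite /m le_min pi_ge0 mdist_ge0 ge_min lexx.
have xy : x = y.
  apply: mdist_positivity; move: m0; rewrite /m /Num.min.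
  by case: ifP => // _ pi0; have := pi_gt0 R; rewrite pi0 ltxx.
by apply/orP; right; apply/eqP; congr pair => //; apply: val_inj.
Qed.

Lemma euclid_triangle (x y z w : R) :
  Num.sqrt ((x + z) ^+ 2 + (y + w) ^+ 2) <=
  Num.sqrt (x ^+ 2 + y ^+ 2) + Num.sqrt (z ^+ 2 + w ^+ 2).
Proof.
set A : R := Num.sqrt (x ^+ 2 + _); set B : R := Num.sqrt (z ^+ 2 + _).
have A0 : 0 <= A by exact: sqrtr_ge0.
have B0 : 0 <= B by exact: sqrtr_ge0.
have A2 : A ^+ 2 = x ^+ 2 + y ^+ 2 by rewrite sqr_sqrtr ?addr_ge0 ?sqr_ge0.
have B2 : B ^+ 2 = z ^+ 2 + w ^+ 2 by rewrite sqr_sqrtr ?addr_ge0 ?sqr_ge0.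
rewrite -ler_sqr ?nnegrE ?addr_ge0 ?sqrtr_ge0//.
rewrite sqr_sqrtr ?addr_ge0 ?sqr_ge0//.
suff xyzw : x * z + y * w <= A * B.
  have -> : (A + B) ^+ 2 = A ^+ 2 + B ^+ 2 + 2 * (A * B) by ring.
  rewrite A2 B2 -subr_ge0.
  rewrite [leRHS](_ : _ = 2 * (A * B - (x * z + y * w))); last by ring.
  by rewrite mulr_ge0// subr_ge0.
have [|xyzw] := leP (x * z + y * w) 0.
  by move=> /le_trans; apply; apply: mulr_ge0.
rewrite -ler_sqr ?nnegrE ?mulr_ge0 ?(ltW xyzw)//.
rewrite exprMn A2 B2 -subr_ge0.
by rewrite [leRHS](_ : _ = (x * w - y * z) ^+ 2) ?sqr_ge0//; ring.
Qed.

Let edist (r s a : R) := Num.sqrt (r ^+ 2 + s ^+ 2 - 2 * r * s * cos a).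

Let edist_le (r s a b : R) : 0 <= r -> 0 <= s -> 0 <= a -> a <= b -> b <= pi ->
  edist r s a <= edist r s b.
Proof.
move=> r0 s0 a0 ab bpi; apply: ler_wsqrtr.
rewrite lerD2l lerN2 ler_wpM2l ?mulr_ge0//.
by rewrite leNgt ltr_cos -?leNgt// in_itv /= ?a0 ?bpi ?(le_trans ab bpi)
  ?(le_trans a0 ab).
Qed.

Let edist_triangle (r s t a b c : R) : 0 <= r -> 0 <= s -> 0 <= t ->
  0 <= a <= pi -> 0 <= b <= pi -> 0 <= c <= pi -> c <= a + b ->
  edist r t c <= edist r s a + edist s t b.
Proof.
move=> r0 s0 t0 /andP[a0 api]; wlog abpi : b / a + b <= pi.
  move=> H /andP[b0 bpi] cpi cab.
  have [ab|/ltW ab] := leP (a + b) pi; first by apply: H => //; rewrite b0.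
  apply: (@le_trans _ _ (edist r s a + edist s t (pi - a))).
    apply: H => //; first by rewrite subrKC.
    - by rewrite subr_ge0 api lerBlDr lerDl.
    - by rewrite subrKC; case/andP: cpi.
  by rewrite lerD2l edist_le// ?subr_ge0// lerBlDl.
move=> /andP[b0 bpi] /andP[c0 cpi] cab.
apply: (@le_trans _ _ (edist r t (a + b))); first exact: edist_le.
have := euclid_triangle (r * cos a - s) (r * sin a)
  (s - t * cos b) (t * sin b).
have ca := cos2Dsin2 a; have cb := cos2Dsin2 b.
rewrite /edist cosD; congr (Num.sqrt _ <= Num.sqrt _ + Num.sqrt _).
- transitivity (r ^+ 2 * (cos a ^+ 2 + sin a ^+ 2)
    + t ^+ 2 * (cos b ^+ 2 + sin b ^+ 2)
    - 2 * r * t * (cos a * cos b - sin a * sin b)); first by ring.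
  by rewrite ca cb !mulr1.
- transitivity (r ^+ 2 * (cos a ^+ 2 + sin a ^+ 2) + s ^+ 2
    - 2 * r * s * cos a); first by ring.
  by rewrite ca !mulr1.
- transitivity (s ^+ 2 + t ^+ 2 * (cos b ^+ 2 + sin b ^+ 2)
    - 2 * s * t * cos b); first by ring.
  by rewrite cb !mulr1.
Qed.

Lemma cone_dist_triangle q p s :
  cone_dist p s <= cone_dist p q + cone_dist q s.
Proof.
elim/quotP: p => -[x r] _; elim/quotP: q => -[y t] _.
elim/quotP: s => -[z u] _; rewrite !piE /pre_cone_dist /=.
have mpi (v w : X) : 0 <= Num.min pi (mdist v w) <= pi.
  by rewrite le_min pi_ge0 mdist_ge0 ge_min lexx.
apply: edist_triangle => //.
have := metric_triangle x y z.
have := mdist_ge0 x y; have := mdist_ge0 y z; have := pi_ge0 R.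
rewrite /Num.min; do 3 case: ltP => ?; lra.
Qed.

HB.instance Definition _ := isMetric.Build R cone
  cone_distxx cone_dist_eq0 cone_dist_sym cone_dist_triangle.

Lemma cone_mdistE (x0 x1 : X) (r0 r1 : {nonneg R}) :
  mdist (cone_pt x0 r0) (cone_pt x1 r1) ^+ 2 =
  r0%:num ^+ 2 + r1%:num ^+ 2
  - 2 * r0%:num * r1%:num * cos (Num.min pi (mdist x0 x1)).
Proof. exact: cone_distE. Qed.

End ConeType.

Arguments apex {R} X.

(* Main.v *)
(* Since [acos] is continuous and decreasing, the cosine of an upper angle is the lower
   double limit of the comparison cosines.  Near a point [x0, r0] with [r0 > 0], a cone
   geodesic is a straight line [s |-> (r0 + c s, k s)] of a planar sector lying over a
   geodesic of the base.  For two such lines of speeds [v1] and [v2], the comparison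
   cosine in the cone is exactly [(c1 c2 + k1 k2 S) / (v1 v2)], where [S] is the spherical
   comparison cosine of the base triangle, and [S] differs from the Euclidean comparison
   cosine by an amount tending to 0.  Hence the quadratic form of the cone is
   the square of a linear form plus the quadratic form of the base with weights
   [b k / v], which gives (b); lines with [c = 0] give (a).  Geodesics from the apex are
   rays, and their angle is the distance in the base truncated at [pi]; (c) and (d) then
   reduce to the sign of a quadratic form in the cosines of these distances. *)
Require Import Defs.
From mathcomp Require Import all_boot all_order all_algebra generic_quotient.
From mathcomp Require Import all_classical all_reals all_analysis.
From mathcomp Require Import ring lra.
Set Implicit Arguments.
Unset Strict Implicit.
Import Order.TTheory GRing.Theory Num.Theory.
Import numFieldNormedType.Exports.
Local Open Scope classical_set_scope.
Local Open Scope ring_scope.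

(** * Estimates for sine and cosine; spherical against Euclidean comparison cosines *)

Section Trigonometry.
Context {R : realType}.
Implicit Types x y a b d : R.

Lemma cos_lipschitz x y : `|cos x - cos y| <= `|x - y|.
Proof.
wlog xy : x y / y <= x.
  by case: (leP y x) => [|/ltW] h H; [|rewrite distrC (distrC x)]; exact: H.
have cosd z : z \in `]y, x[ -> is_derive z 1 cos (- sin z).
  by move=> _; exact: is_derive_cos.
have cosc : {within `[y, x], continuous (@cos R)}.
  by apply: continuous_subspaceT => z; exact: continuous_cos.
have [c _ ->] := MVT_segment xy cosd cosc.
by rewrite normrM normrN ler_piMl// sin_max.
Qed.

(** The mean value theorem gives [sin x = x cos c] with [0 < c < x], and the Lipschitz bound gives
    [cos c >= 1 - c >= 1 - x]. *)
Lemma sin_sandwich x : 0 <= x -> (1 - x) * x <= sin x <= x.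
Proof.
move=> x0.
have sind z : z \in `]0, x[ -> is_derive z 1 sin (cos z).
  by move=> _; exact: is_derive_sin.
have sinc : {within `[0, x], continuous (@sin R)}.
  by apply: continuous_subspaceT => z; exact: continuous_sin.
have [c] := MVT_segment x0 sind sinc.
rewrite in_itv/= sin0 !subr0 => /andP[c0 cx] ->.
rewrite ler_wpM2r//=; first by rewrite ler_piMl// cos_le1.
have := cos_lipschitz 0 c; rewrite cos0 ler_norml sub0r normrN ger0_norm//; lra.
Qed.

Lemma atan_le x : 0 <= x -> atan x <= x.
Proof.
move=> x0.
have datan z : z \in `]0, x[ -> is_derive z 1 atan (1 + z ^+ 2)^-1.
  by move=> _; exact: is_derive1_atan.
have catan : {within `[0, x], continuous (@atan R)}.
  by apply: continuous_subspaceT => z; exact: continuous_atan.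
have [c _] := MVT_segment x0 datan catan.
rewrite atan0 !subr0 => ->; rewrite ler_piMl// invf_le1; first by rewrite lerDl sqr_ge0.
by rewrite ltr_pwDl// sqr_ge0.
Qed.

Lemma cos_le a b : 0 <= a -> a <= b -> b <= pi -> cos b <= cos a.
Proof.
move=> a0 ab bpi; rewrite leNgt ltr_cos -?leNgt// in_itv/=; apply/andP; split; lra.
Qed.

Lemma cos_lt a b : 0 <= a -> a < b -> b <= pi -> cos b < cos a.
Proof.
move=> a0 ab bpi; rewrite ltr_cos// in_itv/=; apply/andP; split; lra.
Qed.

Lemma cos_le_inv a b : 0 <= a <= pi -> 0 <= b <= pi -> cos b <= cos a -> a <= b.
Proof.
by move=> a0 b0; rewrite leNgt => /negP h; rewrite leNgt; apply/negP => ba;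
  apply: h; apply: cos_lt; lra.
Qed.

Lemma cosB_cos a b : cos (a - b) - cos (a + b) = 2 * (sin a * sin b).
Proof. by rewrite cosB cosD; ring. Qed.

(* Both comparison angles satisfy a half-angle product formula:
   [1 - cos] equals [2 ab / (x y)] in the plane and
   [2 sin a sin b / (sin x sin y)] on the sphere, where [a + b = d] and
   [a - b = x - y], so that [a <= x] and [b <= y]. *)
Lemma spherical_euclidean_cos (e : R) : 0 < e -> exists2 h : R, 0 < h &
  forall x y d, 0 < x < h -> 0 < y < h -> `|x - y| <= d <= x + y ->
  `|(cos d - cos x * cos y) / (sin x * sin y)
    - (x ^+ 2 + y ^+ 2 - d ^+ 2) / (2 * x * y)| <= e.
Proof.
wlog e1 : e / e <= 1.
  move=> H e0; have [/H/(_ e0)//|/ltW e1] := leP e 1.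
  have [//|h h0 hh] := H 1 (lexx _); exists h => // x y d hx hy hd.
  exact: (le_trans (hh _ _ _ hx hy hd)).
move=> e0; exists (e / 8); first lra.
move=> x y d /andP[x0 xh] /andP[y0 yh]; rewrite ler_norml => /andP[/andP[d1 d2] d3].
pose a := (d + x - y) / 2; pose b := (d - x + y) / 2.
have a0 : 0 <= a by rewrite /a; lra.
have b0 : 0 <= b by rewrite /b; lra.
have ax : a <= x by rewrite /a; lra.
have bx : b <= y by rewrite /b; lra.
have /andP[sa1 sa2] := sin_sandwich a0; have /andP[sb1 sb2] := sin_sandwich b0.
have /andP[sx1 sx2] := sin_sandwich (ltW x0).
have /andP[sy1 sy2] := sin_sandwich (ltW y0).
(* Below [e / 8] each of the four sines lies between [l] times its argument and the argument, so
   each product of two sines is within a factor [l ^+ 2] of the product of the arguments. *)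
pose l := 1 - e / 8.
have l0 : 0 < l by rewrite /l; lra.
have {sx1} sx1 : l * x <= sin x by apply: le_trans sx1; rewrite ler_pM2r// /l; lra.
have {sy1} sy1 : l * y <= sin y by apply: le_trans sy1; rewrite ler_pM2r// /l; lra.
have {sa1} sa1 : l * a <= sin a by apply: le_trans sa1; rewrite ler_wpM2r// /l; lra.
have {sb1} sb1 : l * b <= sin b by apply: le_trans sb1; rewrite ler_wpM2r// /l; lra.
have sx0 : 0 < sin x by apply: lt_le_trans sx1; rewrite mulr_gt0.
have sy0 : 0 < sin y by apply: lt_le_trans sy1; rewrite mulr_gt0.
have xy0 : 0 < x * y by rewrite mulr_gt0.
have sxy0 : 0 < sin x * sin y by rewrite mulr_gt0.
have p1 : sin x * sin y <= x * y by rewrite ler_pM//; lra.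
have p2 : l ^+ 2 * (x * y) <= sin x * sin y.
  rewrite (_ : l ^+ 2 * _ = (l * x) * (l * y)); last by ring.
  by rewrite ler_pM// mulr_ge0// ltW.
have la : 0 <= l * a by rewrite mulr_ge0// ltW.
have lb : 0 <= l * b by rewrite mulr_ge0// ltW.
have p3 : sin a * sin b <= a * b by rewrite ler_pM//; lra.
have p4 : l ^+ 2 * (a * b) <= sin a * sin b.
  by rewrite (_ : l ^+ 2 * _ = (l * a) * (l * b)); [rewrite ler_pM|ring].
have ab0 : 0 <= a * b by rewrite mulr_ge0.
have abxy : a * b <= x * y by rewrite ler_pM.
have -> : cos d - cos x * cos y = sin x * sin y - 2 * (sin a * sin b).
  have -> : d = a + b by rewrite /a /b; field.
  rewrite -cosB_cos (_ : a - b = x - y); last by rewrite /a /b; field.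
  by rewrite cosB; ring.
have -> : x ^+ 2 + y ^+ 2 - d ^+ 2 = 2 * (x * y) - 4 * (a * b).
  by rewrite /a /b; field.
have ll : 1 - e / 4 <= l ^+ 2 by rewrite /l; nra.
clearbody a b l.
have -> : (sin x * sin y - 2 * (sin a * sin b)) / (sin x * sin y) -
  (2 * (x * y) - 4 * (a * b)) / (2 * x * y)
  = 2 * ((a * b) / (x * y) - (sin a * sin b) / (sin x * sin y)).
  by field; rewrite !gt_eqF.
move: (sin a * sin b) (sin x * sin y) (a * b) (x * y) p1 p2 p3 p4 sxy0 xy0 ab0 abxy.
move=> u v w z p1 p2 p3 p4 v0 z0 w0 wz.
(* The factor lost is recovered by [1 + e / 2]: since [l ^+ 2 >= 1 - e / 4] and [e <= 1], the
   product with [l ^+ 2] is at least 1. *)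
have q : l ^+ 2 * v * (1 + e / 2) >= v.
  have : l ^+ 2 * (1 + e/2) >= 1 by nra.
  by move=> h; rewrite -mulrA (mulrC v) mulrA ler_peMl// ltW.
rewrite (_ : _ - _ = (w * v - u * z) / (z * v)); last by field; rewrite !gt_eqF.
have zv0 : 0 < z * v by rewrite mulr_gt0.
rewrite ler_norml; apply/andP; split.
  suff : - (e / 2) <= (w * v - u * z) / (z * v) by lra.
  rewrite ler_pdivlMr//.
  suff : u * z - w * v <= e / 2 * (z * v) by lra.
  have h1 : u * z <= w * z by rewrite ler_pM2r.
  suff : w * (z - v) <= e/2 * (z * v) by lra.
  have h2 : z - v <= e / 2 * v.
    have : z <= v * (1 + e/2); last by lra.
    have : l^+2 * z * (1 + e/2) <= v * (1 + e/2) by rewrite ler_pM2r//; lra.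
    apply: le_trans; rewrite -mulrA (mulrC z) mulrA ler_peMl// ?ltW//.
    nra.
  apply: (@le_trans _ _ (z * (z - v))); first by rewrite ler_wpM2r// subr_ge0.
  by rewrite mulrCA ler_pM2l.
suff : (w * v - u * z) / (z * v) <= e / 2 by lra.
rewrite ler_pdivrMr//.
have h1 : l ^+ 2 * w * z <= u * z by rewrite ler_pM2r.
suff : w * v - l ^+ 2 * w * z <= e / 2 * (z * v) by lra.
have h3 : w * v <= w * z by rewrite ler_wpM2l.
have : w * (v - l ^+ 2 * z) <= z * (e / 2 * v); last by lra.
have h4 : v - l ^+ 2 * z <= e / 2 * v by nra.
apply: (@le_trans _ _ (w * (e / 2 * v))); first by rewrite ler_wpM2l.
by rewrite ler_wpM2r// mulr_ge0 ?ltW//; lra.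
Qed.

End Trigonometry.

(** * Lower double limits at 0 and their reparametrization *)

Section DoubleLiminf.
Context {R : realType}.
Implicit Types (q : R -> R -> R) (f g : R -> R) (L : R).

(** The lower limit as [s] and [t] decrease to 0 independently: eventually at least [L - e], and
    frequently at most [L + e]. This form avoids filters and extended reals when parameters are
    changed. *)
Definition liminf2 q L :=
  (forall e, 0 < e -> exists2 h, 0 < h &
     forall s t, 0 < s < h -> 0 < t < h -> L - e <= q s t) /\
  (forall e h, 0 < e -> 0 < h ->
     exists s t, [/\ 0 < s < h, 0 < t < h & q s t <= L + e]).

Lemma liminf2_unique q L1 L2 : liminf2 q L1 -> liminf2 q L2 -> L1 = L2.
Proof.
move=> H1 H2; wlog L12 : L1 L2 H1 H2 / L1 < L2.
  by move=> H; have [/(H _ _ H1 H2)|/(H _ _ H2 H1)|] := ltgtP L1 L2.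
case: H1 H2 => [_ H1] [H2 _].
have e0 : 0 < (L2 - L1) / 4 by lra.
have [h h0 {}H2] := H2 _ e0; have [s [t [sh th]]] := H1 _ _ e0 h0.
have := H2 s t sh th; lra.
Qed.

Lemma liminf2_eventually_const q L h : 0 < h ->
  (forall s t, 0 < s < h -> 0 < t < h -> q s t = L) -> liminf2 q L.
Proof.
move=> h0 qL; split=> [e e0|e h' e0 h'0].
  by exists h => // s t sh th; rewrite qL//; lra.
have [m0 mh mh'] : [/\ 0 < Num.min h h', Num.min h h' <= h & Num.min h h' <= h'].
  by rewrite lt_min h0 h'0 !ge_min !lexx orbT.
pose s := Num.min h h' / 2.
have [sh sh'] : 0 < s < h /\ 0 < s < h' by rewrite /s; split; lra.
by exists s, s; split=> //; rewrite qL//; lra.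
Qed.

(** What a change of parameter must satisfy to preserve a lower limit at 0: small parameters have
    small positive values, which carries over the eventual bound, and every small value is taken at
    a small parameter, which carries over the frequent one. *)
Definition homeo_at_0 f :=
  (forall d, 0 < d -> exists2 h, 0 < h & forall s, 0 < s < h -> 0 < f s < d) /\
  (forall d, 0 < d -> exists2 h, 0 < h &
     forall u, 0 < u < h -> exists2 s, 0 < s < d & f s = u).

Lemma homeo_at_0_mono (f sigma : R -> R) (m M : R) : 0 < m -> 0 < M ->
  (forall s, 0 < s <= m -> 0 < f s) ->
  (forall s t, 0 <= s -> s <= t -> t <= m -> f s <= f t) ->
  (forall u, 0 < u <= M -> 0 < sigma u <= m /\ f (sigma u) = u) ->
  homeo_at_0 f.
Proof.
move=> m0 M0 f0 fmono fs; split=> d d0.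
  pose u := Num.min M (d / 2).
  have u0 : 0 < u <= M by rewrite /u lt_min ge_min lexx M0 divr_gt0.
  have ud : u < d by rewrite /u gt_min; apply/orP; right; lra.
  have [/andP[su0 sum] fsu] := fs u u0; exists (sigma u) => // s /andP[s0 ssu].
  rewrite f0 ?s0 ?(le_trans (ltW ssu))//=; apply: le_lt_trans ud.
  by rewrite -fsu fmono// ltW.
(* Values below [f s] are attained before [s]: by monotonicity, [sigma u > s] would give
   [f s <= u]. *)
pose s := Num.min m (d / 2).
have s0 : 0 < s <= m by rewrite /s lt_min ge_min lexx m0 divr_gt0.
have sd : s < d by rewrite /s gt_min; apply/orP; right; lra.
exists (Num.min M (f s)); first by rewrite lt_min M0 f0.
move=> u /andP[u0]; rewrite lt_min => /andP[uM ufs].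
have [|/andP[su0 sum] fsu] := fs u; first by rewrite u0 ltW.
exists (sigma u) => //; rewrite su0/=; apply: le_lt_trans sd.
have [//|/ltW h] := leP (sigma u) s.
have := fmono s (sigma u); rewrite fsu (leNgt (f s)) ufs => H.
by case/andP: s0 => s0 _; have := H (ltW s0) h sum.
Qed.

Lemma liminf2_transfer q q' f g L a b : liminf2 q L ->
  homeo_at_0 f -> homeo_at_0 g -> 0 <= b ->
  (forall e, 0 < e -> exists2 h, 0 < h & forall s t, 0 < s < h -> 0 < t < h ->
     `|q' s t - (a + b * q (f s) (g t))| <= e) ->
  liminf2 q' (a + b * L).
Proof.
move=> [q1 q2] [f1 f2] [g1 g2] b0 qq'.
have eb e : 0 < e -> exists2 e', 0 < e' & b * e' <= e.
  move=> e0; exists (e / (b + 1)); first by rewrite divr_gt0//; lra.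
  by rewrite mulrCA ler_piMr ?(ltW e0)// ler_pdivrMr; lra.
(* In both halves [e] is shared equally between the approximation error and the slack [e'] of [q];
   the denominator [b + 1] in [eb] also covers [b = 0]. *)
split=> [e e0|e h e0 h0].
  have e20 : 0 < e / 2 by lra.
  have [e' e'0 be'] := eb _ e20; have [h1 h10 H1] := q1 _ e'0.
  have [h2 h20 H2] := qq' _ e20.
  have [h3 h30 H3] := f1 _ h10; have [h4 h40 H4] := g1 _ h10.
  exists (Num.min h2 (Num.min h3 h4)); first by rewrite !lt_min h20 h30.
  move=> s t; rewrite !lt_min => /andP[s0 /and3P[s2 s3 s4]] /andP[t0 /and3P[t2 t3 t4]].
  have := H2 s t; rewrite s0 s2 t0 t2 => /(_ isT isT); rewrite ler_norml => /andP[].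
  have := H1 (f s) (g t); rewrite H3 ?s0// H4 ?t0// => /(_ isT isT) H low _.
  have : b * (L - e') <= b * q (f s) (g t) by rewrite ler_wpM2l.
  lra.
have e20 : 0 < e / 2 by lra.
have [e' e'0 be'] := eb _ e20; have [h2 h20 H2] := qq' _ e20.
have d0 : 0 < Num.min h h2 by rewrite lt_min h0.
have [h3 h30 H3] := f2 _ d0; have [h4 h40 H4] := g2 _ d0.
have h340 : 0 < Num.min h3 h4 by rewrite lt_min h30.
have [u [v []]] := q2 _ _ e'0 h340.
rewrite !lt_min => /andP[u0 /andP[u3 u4]] /andP[v0 /andP[v3 v4]] quv.
have [|s /andP[s0 +] fs] := H3 u; first by rewrite u0.
have [|t /andP[t0 +] gt] := H4 v; first by rewrite v0.
rewrite !lt_min => /andP[th th2] /andP[sh sh2].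
exists s, t; rewrite s0 t0 sh th; split=> //.
have := H2 s t; rewrite s0 sh2 t0 th2 => /(_ isT isT); rewrite ler_norml fs gt => /andP[_].
have : b * q u v <= b * (L + e') by rewrite ler_wpM2l.
lra.
Qed.

End DoubleLiminf.

(** * Upper angles as lower limits of comparison cosines *)

Section UpperAngle.
Context {R : realType} {Y : metricType R}.
Implicit Types (a b c : Y) (y : R -> Y).

Definition comparison_cos a b c : R :=
  (mdist a b ^+ 2 + mdist a c ^+ 2 - mdist b c ^+ 2)
  / (2 * mdist a b * mdist a c).

Lemma comparison_cos_itv a b c : a != b -> a != c ->
  -1 <= comparison_cos a b c <= 1.
Proof.
rewrite -!mdist_gt0 /comparison_cos => ab ac.
have := metric_triangle b a c; have := metric_triangle a b c.
have := metric_triangle a c b; rewrite (metric_sym b a) (metric_sym c b).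
move: (mdist a b) (mdist a c) (mdist b c) ab ac => x y z x0 y0 h1 h2 h3.
have xy0 : 0 < 2 * x * y by rewrite !mulr_gt0.
rewrite ler_pdivlMr// ler_pdivrMr//; apply/andP; split; nra.
Qed.

Lemma mdist_geodesic_start (y0 : Y) y (s : R) :
  nontrivial_geodesic_from y0 y -> 0 <= s <= 1 ->
  mdist y0 (y s) = s * mdist (y 0) (y 1).
Proof.
move=> [yg <- _] /[dup] s1 /andP[s0 _].
by rewrite yg ?lexx ?ler01// sub0r normrN ger0_norm.
Qed.

Lemma geodesic_length_gt0 (y0 : Y) y :
  nontrivial_geodesic_from y0 y -> 0 < mdist (y 0) (y 1).
Proof. by case=> _ _; rewrite mdist_gt0. Qed.

Lemma geodesic_neq_start (y0 : Y) y (s : R) :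
  nontrivial_geodesic_from y0 y -> 0 < s <= 1 -> y0 != y s.
Proof.
move=> yg /andP[s0 s1]; rewrite -mdist_gt0 (mdist_geodesic_start yg) ?(ltW s0)//.
by rewrite mulr_gt0// (geodesic_length_gt0 yg).
Qed.

(** On [[0, pi]] the cosine is decreasing, which exchanges upper and lower limits, and 1-Lipschitz,
    so the same [e] serves for the angle and for its cosine. *)
Lemma liminf2_upper_angle (y0 : Y) y1 y2 :
  nontrivial_geodesic_from y0 y1 -> nontrivial_geodesic_from y0 y2 ->
  liminf2 (fun s t => comparison_cos y0 (y1 s) (y2 t))
    (cos (upper_angle y0 y1 y2)).
Proof.
move=> g1 g2; rewrite /upper_angle.
set F := filter_prod _ _; set f := (X in limf_esup X).
(* The small open squares with a corner at the origin form a base of the product filter. *)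
have FP (P : set (R * R)) : F P <->
    exists2 h, 0 < h & forall s t, 0 < s < h -> 0 < t < h -> P (s, t).
  split=> [[[A B]/= [A0 B0] AB]|[h h0 hP]].
    case: A0 => dA /= dA0 HA; case: B0 => dB /= dB0 HB.
    exists (Num.min dA dB); first by rewrite lt_min dA0.
    move=> s t; rewrite !lt_min => /andP[s0 /andP[sA _]] /andP[t0 /andP[_ tB]].
    apply: AB; split=> /=; [apply: HA => //=|apply: HB => //=];
      by rewrite /ball/= sub0r normrN gtr0_norm.
  exists ([set s | 0 < s < h], [set s | 0 < s < h]).
    have N : (0 : R)^'+ [set s | 0 < s < h].
      apply: filterS (filterI (nbhs_right_gt (0 : R)) (nbhs_right_lt h0)).
      by move=> s [/= ? ?]; apply/andP.
    by split.
  by move=> [s t] /= [sh th]; exact: hP.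
have qI s t : 0 < s < 1 -> 0 < t < 1 ->
    -1 <= comparison_cos y0 (y1 s) (y2 t) <= 1.
  move=> /andP[s0 s1] /andP[t0 t1]; apply: comparison_cos_itv.
  - by apply: (geodesic_neq_start g1); rewrite s0 ltW.
  - by apply: (geodesic_neq_start g2); rewrite t0 ltW.
have U0 : (0 <= limf_esup f F)%E.
  rewrite limf_esupE; apply: le_ereal_inf_tmp => _ [V /FP[h h0 hV] <-].
  pose s := Num.min h 1 / 2.
  have m0 : 0 < Num.min h 1 by rewrite lt_min h0 ltr01.
  have mh : Num.min h 1 <= h by rewrite ge_min lexx.
  have m1 : Num.min h 1 <= 1 by rewrite ge_min lexx orbT.
  have sh : s < h by rewrite /s; lra.
  have s1 : s < 1 by rewrite /s; lra.
  have s0 : 0 < s by rewrite /s; lra.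
  apply: le_ereal_sup_tmp; exists (f (s, s)).
    by exists (s, s) => //; apply: hV; rewrite s0 sh.
  by rewrite lee_fin acos_ge0// qI ?s0.
have Upi : (limf_esup f F <= pi%:E)%E.
  rewrite limf_esupE.
  apply: (@le_trans _ _ (ereal_sup (f @` [set p | 0 < p.1 < 1 /\ 0 < p.2 < 1]))).
    apply: ereal_inf_lbound; exists [set p | 0 < p.1 < 1 /\ 0 < p.2 < 1] => //.
    by apply/FP; exists 1 => // s t.
  apply: ge_ereal_sup => _ [[s t]/= [s1 t1] <-].
  by rewrite lee_fin acos_lepi// qI.
have := limf_esupE f F; move: (limf_esup f F) U0 Upi => U U0 Upi HU.
(* The bounds 0 and [pi] exclude infinite values, so [fine] returns the true limsup. *)
have Ufin : U \is a fin_num by rewrite fin_numE; case: U U0 Upi {HU}.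
split=> [e e0|e h e0 h0].
  have : (U < (fine U + e)%:E)%E by rewrite EFinD fineK// lteDl.
  rewrite {1}HU => /ereal_inf_lt[_ [V /FP[h h0 hV] <-] Ve].
  exists (Num.min h 1); first by rewrite lt_min h0 ltr01.
  move=> s t; rewrite !lt_min => /andP[s0 /andP[sh s1]] /andP[t0 /andP[th t1]].
  have : (f (s, t) < (fine U + e)%:E)%E.
    apply: le_lt_trans Ve; apply: ereal_sup_ubound; exists (s, t) => //.
    by apply: hV; rewrite ?s0 ?t0 ?sh ?th.
  have qst : -1 <= comparison_cos y0 (y1 s) (y2 t) <= 1 by rewrite qI// ?s0 ?t0.
  rewrite lte_fin -[comparison_cos _ _ _]acosK ?in_itv//= => H.
  have := acos_ge0 qst; have := acos_lepi qst.
  rewrite -/(comparison_cos _ _ _) /comparison_angle -/(comparison_cos _ _ _) in H *.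
  move: (acos _) H => A H Api A0.
  have u0 : 0 <= fine U by rewrite fine_ge0.
  have upi : fine U <= pi by rewrite -lee_fin fineK.
  have [Au|uA] := leP A (fine U).
    by rewrite lerBlDr (le_trans (cos_le A0 Au upi))// lerDl ltW.
  have := cos_lipschitz A (fine U).
  by rewrite (gtr0_norm (x := A - fine U)) ?subr_gt0// ler_norml => /andP[]; lra.
pose V := [set p : R * R | 0 < p.1 < Num.min h 1 /\ 0 < p.2 < Num.min h 1].
have : ((fine U - e)%:E < ereal_sup (f @` V))%E.
  apply: (@lt_le_trans _ _ U).
    by rewrite EFinB fineK// lteBlDr// lteDl.
  by rewrite HU; apply: ereal_inf_lbound; exists V => //;
    apply/FP; exists (Num.min h 1); rewrite ?lt_min ?h0 ?ltr01.
move=> /ereal_sup_gt[_ [[s t] [/= sm tm] <-]].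
move: sm tm; rewrite !lt_min => /andP[s0 /andP[sh s1]] /andP[t0 /andP[th t1]].
have qst : -1 <= comparison_cos y0 (y1 s) (y2 t) <= 1 by rewrite qI// ?s0 ?t0.
rewrite lte_fin -/(comparison_cos _ _ _) => H; exists s, t; rewrite s0 t0; split=> //.
rewrite -[comparison_cos _ _ _]acosK ?in_itv//=.
have := acos_ge0 qst; have := acos_lepi qst.
rewrite -/(comparison_cos _ _ _) /comparison_angle -/(comparison_cos _ _ _) in H *.
move: (acos _) H => A H Api A0.
have u0 : 0 <= fine U by rewrite fine_ge0.
have upi : fine U <= pi by rewrite -lee_fin fineK.
have [uA|Au] := leP (fine U) A; first by rewrite (le_trans (cos_le u0 uA Api))// lerDl ltW.
have := cos_lipschitz (fine U) A.
rewrite (gtr0_norm (x := fine U - A)) ?subr_gt0// ler_norml => /andP[]; lra.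
Qed.

End UpperAngle.

(** * The angle between two cone lines off the apex *)

Section ConeAngle.
Context {R : realType} {X : metricType R}.
Implicit Types (x : R -> X) (y : R -> cone X) (u : R -> R) (c k : R).

(* In polar coordinates around the apex, with angles measured from the ray
   through [x0], the curve [y] is the straight line [s |-> (r0 + c s, k s)];
   its projection to the base runs along [x] with parameter [u]. *)
Definition cone_line (x0 : X) (r0 : R) y c k x u :=
  exists (r : R -> {nonneg R}) (h : R), 0 < h /\ forall s, 0 < s < h ->
    [/\ y s = cone_pt (x (u s)) (r s), 0 < (r s)%:num,
        mdist x0 (x (u s)) <= pi / 2,
        (r s)%:num * cos (mdist x0 (x (u s))) = r0 + c * s &
        (r s)%:num * sin (mdist x0 (x (u s))) = k * s].

(** In the three laws of cosines the squares of [r1] and [r2] cancel; after substitution the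
    numerator is exactly [2 s t (c1 c2 + B)], so no error term arises. *)
Lemma comparison_cos_cone (x0 x1 x2 : X) (r0 r1 r2 : {nonneg R})
    (s t v1 v2 c1 c2 B : R) :
  s != 0 -> t != 0 -> v1 != 0 -> v2 != 0 ->
  mdist (cone_pt x0 r0) (cone_pt x1 r1) = s * v1 ->
  mdist (cone_pt x0 r0) (cone_pt x2 r2) = t * v2 ->
  r1%:num * cos (Num.min pi (mdist x0 x1)) = r0%:num + c1 * s ->
  r2%:num * cos (Num.min pi (mdist x0 x2)) = r0%:num + c2 * t ->
  r1%:num * r2%:num * cos (Num.min pi (mdist x1 x2)) =
    (r0%:num + c1 * s) * (r0%:num + c2 * t) + s * t * B ->
  comparison_cos (cone_pt x0 r0) (cone_pt x1 r1) (cone_pt x2 r2)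
  = (c1 * c2 + B) / (v1 * v2).
Proof.
move=> s0 t0 v10 v20 d1 d2 e1 e2 e12; rewrite /comparison_cos !cone_mdistE d1 d2.
rewrite (_ : _ - _ = 2 * (r0%:num * (r0%:num - r1%:num * cos (Num.min pi (mdist x0 x1))
    - r2%:num * cos (Num.min pi (mdist x0 x2)))
    + r1%:num * r2%:num * cos (Num.min pi (mdist x1 x2)))); last by ring.
by rewrite e1 e2 e12; field; rewrite ?s0 ?t0 ?v10 ?v20.
Qed.

(** The conditions on [x1] and [x2] are conditional because a line with [k = 0] is radial and
    projects to the single point [x0]; the meaningless base angle is then killed by the factor
    [k1 * k2]. For positive slopes the limit is transferred from the base with additive constant
    [c1 c2 / (v1 v2)] and factor [k1 k2 / (v1 v2)]. *)
Lemma upper_angle_cone_line (x0 : X) (r0 : {nonneg R}) y1 y2 c1 c2 k1 k2 x1 x2 u1 u2 :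
  nontrivial_geodesic_from (cone_pt x0 r0) y1 ->
  nontrivial_geodesic_from (cone_pt x0 r0) y2 ->
  cone_line x0 r0%:num y1 c1 k1 x1 u1 -> cone_line x0 r0%:num y2 c2 k2 x2 u2 ->
  0 <= k1 -> 0 <= k2 ->
  (0 < k1 -> nontrivial_geodesic_from x0 x1 /\ homeo_at_0 u1) ->
  (0 < k2 -> nontrivial_geodesic_from x0 x2 /\ homeo_at_0 u2) ->
  cos (upper_angle (cone_pt x0 r0) y1 y2) =
    (c1 * c2 + k1 * k2 * cos (upper_angle x0 x1 x2))
    / (mdist (y1 0) (y1 1) * mdist (y2 0) (y2 1)).
Proof.
move=> g1 g2 [r1 [h1 [h10 H1]]] [r2 [h2 [h20 H2]]] k10 k20 G1 G2.
set v1 := mdist (y1 0) _; set v2 := mdist (y2 0) _.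
have v10 : 0 < v1 := geodesic_length_gt0 g1.
have v20 : 0 < v2 := geodesic_length_gt0 g2.
have pi0 := pi_gt0 R.
have minpi (d : R) : d <= pi -> Num.min pi d = d by move=> dpi; rewrite min_r.
have exact_cos s t B : 0 < s < Num.min h1 1 -> 0 < t < Num.min h2 1 ->
    (r1 s)%:num * (r2 t)%:num * cos (Num.min pi (mdist (x1 (u1 s)) (x2 (u2 t)))) =
      (r0%:num + c1 * s) * (r0%:num + c2 * t) + s * t * B ->
    comparison_cos (cone_pt x0 r0) (y1 s) (y2 t) = (c1 * c2 + B) / (v1 * v2).
  rewrite !lt_min => /andP[s0 /andP[sh s1]] /andP[t0 /andP[th t1]].
  have [|ys rs ds cs ss] := H1 s; first by rewrite s0.
  have [|yt rt dt ct st] := H2 t; first by rewrite t0.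
  have := @mdist_geodesic_start _ _ _ _ s g1; rewrite (ltW s0) (ltW s1) => /(_ isT).
  have := @mdist_geodesic_start _ _ _ _ t g2; rewrite (ltW t0) (ltW t1) => /(_ isT).
  rewrite ys yt => dp2 dp1.
  move=> E; apply: (comparison_cos_cone _ _ _ _ dp1 dp2 _ _ E); rewrite ?gt_eqF//.
  - by rewrite minpi ?cs//; lra.
  - by rewrite minpi ?ct//; lra.
apply: (liminf2_unique (liminf2_upper_angle g1 g2)).
have h0 : 0 < Num.min (Num.min h1 1) (Num.min h2 1).
  by rewrite !lt_min h10 h20 ltr01.
have radial (x : R -> X) (u r : R) : 0 < r -> mdist x0 (x u) <= pi / 2 ->
    r * sin (mdist x0 (x u)) = 0 -> x u = x0.
  move=> r_gt0 d1 /eqP; rewrite mulf_eq0 gt_eqF//= => /eqP sd0.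
  apply/esym/eqP/negPn/negP; rewrite -mdist_gt0 => d0.
  by have := @sin_gt0_pi _ (mdist x0 (x u)); rewrite d0 sd0 ltxx => H;
    have := H ltac:(lra).
(* A radial first line stays over [x0], so the comparison cosine is constant and the formula holds
   with [B = 0]; the second line is treated symmetrically below. *)
have [k1e|k1n] := eqVneq k1 0.
  apply: (liminf2_eventually_const h0) => s t; rewrite lt_min andbA.
  move=> /andP[sh1 _]; rewrite (minC (Num.min h1 1)) lt_min andbA => /andP[th2 _].
  rewrite k1e !mul0r; apply: exact_cos => //.
  move: sh1 th2; rewrite !lt_min !andbA => /andP[sh1 _] /andP[th2 _].
  have [_ rs ds cs] := H1 s sh1; rewrite k1e mul0r => /(radial _ _ _ rs ds) xs.
  have [_ rt dt ct _] := H2 t th2.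
  move: cs; rewrite xs mdistxx cos0 mulr1 => ->.
  by rewrite minpi -?mulrA ?ct ?mulr0 ?addr0//; lra.
have [k2e|k2n] := eqVneq k2 0.
  apply: (liminf2_eventually_const h0) => s t; rewrite lt_min andbA.
  move=> /andP[sh1 _]; rewrite (minC (Num.min h1 1)) lt_min andbA => /andP[th2 _].
  rewrite k2e mulr0 mul0r; apply: exact_cos => //.
  move: sh1 th2; rewrite !lt_min !andbA => /andP[sh1 _] /andP[th2 _].
  have [_ rt dt ct] := H2 t th2; rewrite k2e mul0r => /(radial _ _ _ rt dt) xt.
  have [_ rs ds cs _] := H1 s sh1.
  move: ct; rewrite xt mdistxx cos0 mulr1 => ->.
  by rewrite metric_sym minpi -?cs ?mulr0 ?addr0; [ring|lra].
have k1p : 0 < k1 by rewrite lt_def k1n.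
have k2p : 0 < k2 by rewrite lt_def k2n.
have [gx1 hu1] := G1 k1p; have [gx2 hu2] := G2 k2p.
rewrite mulrDl (mulrAC (k1 * k2)).
have b0 : 0 <= k1 * k2 / (v1 * v2) by rewrite divr_ge0// ltW// mulr_gt0.
apply: (liminf2_transfer (liminf2_upper_angle gx1 gx2) hu1 hu2 b0) => e e0.
set b := k1 * k2 / _ in b0 *.
have e'0 : 0 < e / (b + 1) by rewrite divr_gt0//; lra.
have [h /= h_gt0 He] := spherical_euclidean_cos e'0.
set l1 := mdist (x1 0) (x1 1); set l2 := mdist (x2 0) (x2 1).
have l10 : 0 < l1 := geodesic_length_gt0 gx1.
have l20 : 0 < l2 := geodesic_length_gt0 gx2.
have small (u : R -> R) l : 0 < l -> homeo_at_0 u -> exists2 h', 0 < h' &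
    forall s, 0 < s < h' -> 0 < u s <= 1 /\ 0 < u s * l < h.
  move=> l0 [hu _]; have [|h' h'0 hh'] := hu (Num.min 1 (h / l)).
    by rewrite lt_min ltr01 divr_gt0.
  exists h' => // s /hh'; rewrite lt_min => /andP[us0 /andP[us1 ush]].
  by rewrite us0 ltW// mulr_gt0//= -ltr_pdivlMr.
have [h3 h30 H3] := small u1 l1 l10 hu1.
have [h4 h40 H4] := small u2 l2 l20 hu2.
exists (Num.min (Num.min (Num.min h1 1) (Num.min h2 1)) (Num.min h3 h4)).
  by rewrite lt_min h0 lt_min h30.
move=> s t; rewrite !lt_min.
move=> /andP[s0 /andP[/andP[/andP[sh1 s1] /andP[sh2 _]] /andP[sh3 sh4]]].
move=> /andP[t0 /andP[/andP[/andP[th1 t1] /andP[th2 _]] /andP[th3 th4]]].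
have [|_ rs ds cs ss] := H1 s; first by rewrite s0.
have [|_ rt dt ct st] := H2 t; first by rewrite t0.
have [|us1 usl] := H3 s; first by rewrite s0.
have [|ut1 utl] := H4 t; first by rewrite t0.
have dxs : mdist x0 (x1 (u1 s)) = u1 s * l1.
  by apply: (mdist_geodesic_start gx1); case/andP: us1 => /ltW ->.
have dxt : mdist x0 (x2 (u2 t)) = u2 t * l2.
  by apply: (mdist_geodesic_start gx2); case/andP: ut1 => /ltW ->.
have tri : `|u1 s * l1 - u2 t * l2| <= mdist (x1 (u1 s)) (x2 (u2 t))
    <= u1 s * l1 + u2 t * l2.
  have := metric_triangle (x1 (u1 s)) x0 (x2 (u2 t)).
  have := metric_triangle x0 (x1 (u1 s)) (x2 (u2 t)).
  have := metric_triangle x0 (x2 (u2 t)) (x1 (u1 s)).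
  rewrite (metric_sym (x2 (u2 t)) (x1 (u1 s))) (metric_sym (x1 (u1 s)) x0) dxs dxt.
  by move=> *; rewrite ler_norml; do ?[apply/andP; split]; lra.
rewrite dxs in ds cs ss; rewrite dxt in dt ct st.
have := He _ _ _ usl utl tri.
set S := (_ / (sin _ * sin _)) => SE.
have -> : comparison_cos (cone_pt x0 r0) (y1 s) (y2 t)
    = (c1 * c2 + k1 * k2 * S) / (v1 * v2).
  apply: exact_cos; rewrite ?lt_min ?s0 ?sh1 ?s1 ?t0 ?th2//.
  rewrite minpi; last by case/andP: tri => _ /le_trans; apply; lra.
  have sin_neq0 d : 0 < d -> d <= pi / 2 -> sin d != 0.
    by move=> d0 d1; rewrite gt_eqF// sin_gt0_pi//; lra.
  have [s1n s2n] : sin (u1 s * l1) != 0 /\ sin (u2 t * l2) != 0.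
    by case/andP: usl => ? _; case/andP: utl => ? _; rewrite !sin_neq0.
  have -> : cos (mdist (x1 (u1 s)) (x2 (u2 t))) = cos (u1 s * l1) * cos (u2 t * l2)
      + sin (u1 s * l1) * sin (u2 t * l2) * S.
    by rewrite /S; field; rewrite ?s1n ?s2n.
  transitivity ((r1 s)%:num * cos (u1 s * l1) * ((r2 t)%:num * cos (u2 t * l2))
     + (r1 s)%:num * sin (u1 s * l1) * ((r2 t)%:num * sin (u2 t * l2)) * S).
    by ring.
  by rewrite cs ss ct st; ring.
rewrite /comparison_cos dxs dxt; set E := (X in b * X).
have -> : (c1 * c2 + k1 * k2 * S) / (v1 * v2) - (c1 * c2 / (v1 * v2) + b * E)
    = b * (S - E) by rewrite /b; field; rewrite ?gt_eqF.
rewrite normrM (ger0_norm b0) (le_trans (ler_wpM2l b0 SE))//.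
by rewrite mulrCA ler_piMr ?(ltW e0)// ler_pdivrMr; lra.
Qed.

End ConeAngle.

(** * Plane geometry: collinear points and the inverse of the polar angle *)

Section PlanarLines.
Context {R : realType}.

(** Put planar points at radii [r0], [rs], [rt] and angles 0, [a], [a + b]. The triangle inequality
    bounds the distance from the first to the last by [t v], the distance belonging to angle [c], so
    [a + b <= c]. The equality case then places the middle point on the segment at ratio [s : t]. *)
Lemma collinear_equality (r0 rs rt a b c s t v : R) :
  0 < r0 -> 0 < rs -> 0 < rt -> 0 <= s <= t -> 0 <= v ->
  0 <= a -> 0 <= b -> 0 <= c <= pi -> c <= a + b -> a + b <= pi ->
  (s * v) ^+ 2 = r0 ^+ 2 + rs ^+ 2 - 2 * r0 * rs * cos a ->
  ((t - s) * v) ^+ 2 = rs ^+ 2 + rt ^+ 2 - 2 * rs * rt * cos b ->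
  (t * v) ^+ 2 = r0 ^+ 2 + rt ^+ 2 - 2 * r0 * rt * cos c ->
  [/\ c = a + b, t * (rs * cos a - r0) = s * (rt * cos c - r0)
    & t * (rs * sin a) = s * (rt * sin c)].
Proof.
move=> r00 rs0 rt0 /andP[s0 st] v0 a0 b0 /andP[c0 cpi] cab abpi E1 E2 E3.
have ca := cos2Dsin2 a.
pose p1 := rs * cos a - r0; pose p2 := rs * sin a.
have P2 : p1 ^+ 2 + p2 ^+ 2 = (s * v) ^+ 2.
  rewrite E1 /p1 /p2 (_ : _ + _ = rs ^+ 2 * (cos a ^+ 2 + sin a ^+ 2) + r0 ^+ 2
    - 2 * r0 * rs * cos a); [by rewrite ca; ring|by ring].
pose q1 d := rt * cos d - r0; pose q2 d := rt * sin d.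
have Q2 d : q1 d ^+ 2 + q2 d ^+ 2 = r0 ^+ 2 + rt ^+ 2 - 2 * r0 * rt * cos d.
  rewrite /q1 /q2 (_ : _ + _ = rt ^+ 2 * (cos d ^+ 2 + sin d ^+ 2) + r0 ^+ 2
    - 2 * r0 * rt * cos d); [by rewrite cos2Dsin2; ring|by ring].
have PQ2 : (q1 (a + b) - p1) ^+ 2 + (q2 (a + b) - p2) ^+ 2 = ((t - s) * v) ^+ 2.
  rewrite E2 /q1 /q2 /p1 /p2 cosD sinD.
  transitivity (rt ^+ 2 * ((cos a ^+ 2 + sin a ^+ 2) * (cos b ^+ 2 + sin b ^+ 2))
    + rs ^+ 2 * (cos a ^+ 2 + sin a ^+ 2)
    - 2 * rs * rt * cos b * (cos a ^+ 2 + sin a ^+ 2)); first by ring.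
  by rewrite !cos2Dsin2; ring.
have cE : c = a + b.
  apply/eqP; rewrite eq_le cab/= cos_le_inv ?c0 ?addr_ge0//.
  suff : q1 (a + b) ^+ 2 + q2 (a + b) ^+ 2 <= (t * v) ^+ 2.
    rewrite Q2 E3 lerD2l lerN2 ler_pM2l//.
    by rewrite !mulr_gt0.
  have sv0 : 0 <= s * v by rewrite mulr_ge0.
  have tsv0 : 0 <= (t - s) * v by rewrite mulr_ge0// subr_ge0.
  have tri := euclid_triangle p1 p2 (q1 (a + b) - p1) (q2 (a + b) - p2).
  move: tri; rewrite !subrKC P2 PQ2 !sqrtr_sqr !ger0_norm// => tri.
  rewrite -(@sqr_sqrtr _ (q1 _ ^+ 2 + _)) ?addr_ge0 ?sqr_ge0//.
  have tv0 : 0 <= t * v by rewrite mulr_ge0// (le_trans s0).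
  by rewrite ler_sqr ?nnegrE ?sqrtr_ge0// (le_trans tri)//; lra.
have Q := Q2 c; rewrite -E3 in Q; rewrite -cE in PQ2.
(* This is Stewart's relation: the squared length of [t p - s q] is a combination of the three
   squared distances, which vanishes when they are [s v], [t v] and [(t - s) v]. *)
have Z : (t * p1 - s * q1 c) ^+ 2 + (t * p2 - s * q2 c) ^+ 2 = 0.
  rewrite (_ : _ + _ = t * (t - s) * (p1 ^+ 2 + p2 ^+ 2)
     - s * (t - s) * (q1 c ^+ 2 + q2 c ^+ 2)
     + s * t * ((q1 c - p1) ^+ 2 + (q2 c - p2) ^+ 2)); last by ring.
  by rewrite P2 Q PQ2; ring.
move/eqP: Z; rewrite paddr_eq0 ?sqr_ge0// !sqrf_eq0 !subr_eq0 => /andP[/eqP Z1 /eqP Z2].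
by split.
Qed.

(* The inverse comes from [eps (k cos p - c sin p) = r eps sin (th eps - p) + r0 sin p],
   which makes the denominator positive and the parameter at most [eps]. *)
Lemma line_angle_inverse (r0 c k eps : R) (r th : R -> R) :
  0 < r0 -> 0 < k -> 0 < eps ->
  (forall s, 0 <= s <= eps -> [/\ 0 < r s, 0 <= th s < pi / 2,
     r s * cos (th s) = r0 + c * s & r s * sin (th s) = k * s]) ->
  exists sigma : R -> R, forall p, 0 <= p <= th eps ->
    [/\ 0 <= sigma p <= eps, 0 < p -> 0 < sigma p & th (sigma p) = p].
Proof.
move=> r00 k0 e0 H.
have [|re0 /andP[T0 T1] ce se] := H eps; first by rewrite (ltW e0) lexx.
set T := th eps in T0 T1 ce se *; set re := r eps in re0 ce se.
have sT0 : 0 < sin T by rewrite -(pmulr_rgt0 _ re0) se mulr_gt0.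
pose f p := k * cos p - c * sin p.
have ef p : eps * f p = re * sin (T - p) + r0 * sin p.
  transitivity ((k * eps) * cos p - ((r0 + c * eps) - r0) * sin p).
    by rewrite /f; ring.
  by rewrite -se -ce sinB; ring.
have pi0 := pi_gt0 R.
have rT0 p : 0 <= p <= T -> 0 <= re * sin (T - p).
  by move=> p0; rewrite mulr_ge0 ?(ltW re0)// sin_ge0_pi//; lra.
have r0p p : 0 <= p <= T -> 0 <= r0 * sin p.
  by move=> p0; rewrite mulr_ge0 ?(ltW r00)// sin_ge0_pi//; lra.
have f0 p : 0 <= p <= T -> 0 < f p.
  move=> p0; rewrite -(pmulr_rgt0 _ e0) ef.
  have [pe|pn] := eqVneq p 0; first by rewrite pe subr0 sin0 mulr0 addr0 mulr_gt0.
  have p_gt0 : 0 < p by rewrite lt_def pn; case/andP: p0.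
  by rewrite ltr_wpDl ?rT0// mulr_gt0// sin_gt0_pi//; lra.
(* The line [(r0 + c s, k s)] meets the ray at angle [p] when [s (k cos p - c sin p) = r0 sin p]. *)
exists (fun p => r0 * sin p / f p) => p pT.
have fp := f0 _ pT.
have se0 : 0 <= r0 * sin p / f p <= eps.
  rewrite divr_ge0 ?r0p ?(ltW fp)//= ler_pdivrMr// ef; have := rT0 _ pT; lra.
split=> //.
  move=> p0; rewrite divr_gt0// mulr_gt0// sin_gt0_pi//; lra.
have [r_gt0 /andP[t0 t1] cs ss] := H _ se0.
set s := r0 * sin p / f p in se0 r_gt0 t0 t1 cs ss *.
have cs' : r0 + c * s = r0 * k / f p * cos p.
  by rewrite /s /f; field; rewrite gt_eqF.
have ss' : k * s = r0 * k / f p * sin p by rewrite /s; ring.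
apply/eqP; rewrite -subr_eq0; apply/eqP/sin_inj; rewrite ?sin0 ?in_itv/=.
- by apply/andP; split; lra.
- by apply/andP; split; lra.
apply: (mulfI (lt0r_neq0 r_gt0)); rewrite sinB mulr0.
rewrite (_ : r s * _ = r s * sin (th s) * cos p - r s * cos (th s) * sin p); last by ring.
by rewrite ss cs cs' ss'; ring.
Qed.

End PlanarLines.

(** * Geodesics of the cone off the apex, and lifts of base geodesics *)

Section ConeGeodesics.
Context {R : realType} {X : metricType R}.

Lemma cone_ptP (p : cone X) : exists x r, p = cone_pt x r.
Proof.
exists (repr p).1, (repr p).2.
by rewrite /cone_pt -surjective_pairing reprK.
Qed.

Lemma cone_pt_inj (x x' : X) (r r' : {nonneg R}) :
  cone_pt x r = cone_pt x' r' -> 0 < r%:num -> x = x' /\ r = r'.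
Proof.
move=> /eqP; rewrite /cone_pt piE /= /cone_rel /= => /orP[/andP[/eqP-> _]|/eqP[-> ->]//].
by rewrite ltxx.
Qed.

Lemma cone_radius_dist (x x' : X) (r r' : {nonneg R}) :
  `|r%:num - r'%:num| <= mdist (cone_pt x r) (cone_pt x' r').
Proof.
rewrite -ler_sqr ?nnegrE ?mdist_ge0// cone_mdistE real_normK ?num_real//.
have := cos_le1 (Num.min pi (mdist x x')); move: (cos _) => d d1.
have : 0 <= r%:num * r'%:num * (1 - d) by rewrite !mulr_ge0// subr_ge0.
lra.
Qed.

(** Near its start the geodesic stays far from the apex and spans angles below [pi / 2], so its cone
    distances are planar ones. Their additivity along the geodesic makes the angles add up and the
    planar coordinates affine, by [collinear_equality]. *)
Lemma cone_geodesic_polar (x0 : X) (r0 : {nonneg R}) (y : R -> cone X) :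
  0 < r0%:num -> nontrivial_geodesic_from (cone_pt x0 r0) y ->
  exists (xi : R -> X) (r : R -> {nonneg R}) (c k eps : R),
  [/\ 0 < eps, 0 <= k, xi 0 = x0,
    forall s, 0 <= s <= eps -> [/\ y s = cone_pt (xi s) (r s), 0 < (r s)%:num,
      mdist x0 (xi s) < pi / 2,
      (r s)%:num * cos (mdist x0 (xi s)) = r0%:num + c * s &
      (r s)%:num * sin (mdist x0 (xi s)) = k * s] &
    forall s t, 0 <= s -> s <= t -> t <= eps ->
      mdist x0 (xi t) = mdist x0 (xi s) + mdist (xi s) (xi t)].
Proof.
move=> r00 yg; have [yG y00 _] := yg.
have v0 := geodesic_length_gt0 yg; set v := mdist (y 0) (y 1) in v0 *.
have pi0 := pi_gt0 R.
have [xr xrE] : exists xr : R -> X * {nonneg R},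
    forall s, y s = cone_pt (xr s).1 (xr s).2.
  exists (fun s => repr (y s)) => s.
  by rewrite /cone_pt -surjective_pairing reprK.
pose xi s := (xr s).1; pose r s := (xr s).2.
(* Up to [eps] the distance travelled is at most [r0 / 4], so all radii remain at least [3 / 4] of
   [r0]. *)
pose eps := Num.min 1 (r0%:num / (4 * v)).
have eps0 : 0 < eps by rewrite lt_min ltr01 divr_gt0// mulr_gt0.
have eps1 : eps <= 1 by rewrite ge_min lexx.
have epsv : eps * v <= r0%:num / 4.
  rewrite -ler_pdivlMr// (_ : _ / _ / _ = r0%:num / (4 * v)) ?ge_min ?lexx ?orbT//.
  by field; rewrite gt_eqF.
have dist (s t : R) : 0 <= s -> s <= t -> t <= eps ->
    mdist (cone_pt (xi s) (r s)) (cone_pt (xi t) (r t)) = (t - s) * v.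
  move=> s0 st te; rewrite -!xrE yG; [|by apply/andP; split; lra..].
  by rewrite distrC ger0_norm// subr_ge0.
have [xi0 rE0] : xi 0 = x0 /\ r 0 = r0.
  by have [] := @cone_pt_inj x0 (xi 0) r0 (r 0) _ r00; rewrite -?xrE.
have rs (s : R) : 0 <= s -> s <= eps -> 3 / 4 * r0%:num <= (r s)%:num.
  move=> s0 se; have := cone_radius_dist (xi 0) (xi s) (r 0) (r s).
  rewrite dist// subr0 rE0 => h.
  have : s * v <= eps * v by rewrite ler_pM2r.
  move: h; rewrite ler_norml => /andP[]; lra.
(* An angle of [pi / 2] or more would make the distance at least the radius [r s], hence at least
   [3 / 4] of [r0], against [r0 / 4]. *)
have dx (s t : R) : 0 <= s -> s <= t -> t <= eps -> mdist (xi s) (xi t) < pi / 2.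
  move=> s0 st te; rewrite ltNge; apply/negP => d.
  have c0 : cos (Num.min pi (mdist (xi s) (xi t))) <= 0.
    have -> : 0 = cos (pi / 2) :> R by rewrite cos_pihalf.
    by apply: cos_le; rewrite ?ge_min ?lexx// ?le_min ?d; [lra|rewrite andbT; lra].
  have := cone_mdistE (xi s) (xi t) (r s) (r t); rewrite dist//.
  move: (cos _) c0 => C C0 E.
  have h1 : (t - s) * v <= r0%:num / 4.
    by apply: le_trans epsv; rewrite ler_pM2r//; lra.
  have h0 : 0 <= (t - s) * v by rewrite mulr_ge0 ?subr_ge0// ltW.
  have h2 : ((t - s) * v) ^+ 2 <= (r0%:num / 4) ^+ 2 by rewrite ler_sqr ?nnegrE//; lra.
  have rs1 := rs s s0 (le_trans st te); have rt1 := rs t (le_trans s0 st) te.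
  have h3 : (3 / 4 * r0%:num) ^+ 2 <= (r s)%:num ^+ 2 by rewrite ler_sqr ?nnegrE//; lra.
  have h4 : 0 <= (r s)%:num * (r t)%:num * - C by rewrite !mulr_ge0// oppr_ge0.
  have h5 := sqr_ge0 (r t)%:num.
  have h6 : 0 < r0%:num ^+ 2 by rewrite exprn_gt0.
  lra.
have rpos (s : R) : 0 <= s -> s <= eps -> 0 < (r s)%:num.
  by move=> s0 se; apply: lt_le_trans (rs s s0 se); rewrite mulr_gt0//; lra.
have coll (s t : R) : 0 <= s -> s <= t -> t <= eps ->
  [/\ mdist x0 (xi t) = mdist x0 (xi s) + mdist (xi s) (xi t),
    t * ((r s)%:num * cos (mdist x0 (xi s)) - r0%:num)
     = s * ((r t)%:num * cos (mdist x0 (xi t)) - r0%:num) &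
    t * ((r s)%:num * sin (mdist x0 (xi s)))
     = s * ((r t)%:num * sin (mdist x0 (xi t)))].
  move=> s0 st te.
  have t0 := le_trans s0 st; have se := le_trans st te.
  have d1 := dist 0 s (lexx 0) s0 se; have d2 := dist s t s0 st te.
  have d3 := dist 0 t (lexx 0) t0 te.
  have x1 := dx 0 s (lexx 0) s0 se; have x2 := dx s t s0 st te.
  have x3 := dx 0 t (lexx 0) t0 te.
  rewrite xi0 rE0 in d1 d3 x1 x3.
  rewrite !subr0 in d1 d3.
  have minpi (d : R) : d < pi / 2 -> Num.min pi d = d by move=> h; rewrite min_r//; lra.
  have e1 := cone_mdistE x0 (xi s) r0 (r s); rewrite d1 minpi// in e1.
  have e2 := cone_mdistE (xi s) (xi t) (r s) (r t); rewrite d2 minpi// in e2.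
  have e3 := cone_mdistE x0 (xi t) r0 (r t); rewrite d3 minpi// in e3.
  apply: (collinear_equality r00 _ _ _ _ (mdist_ge0 _ _) (mdist_ge0 _ _) _
    (metric_triangle _ _ _) _ e1 e2 e3) => //.
  - exact: rpos.
  - exact: rpos.
  - by rewrite s0.
  - exact: ltW.
  - by rewrite mdist_ge0/=; lra.
  - lra.
(* The slopes are read off at the endpoint [eps]; proportionality to it gives the affine formulas at
   every earlier [s]. *)
exists xi, r, (((r eps)%:num * cos (mdist x0 (xi eps)) - r0%:num) / eps),
  ((r eps)%:num * sin (mdist x0 (xi eps)) / eps), eps.
split=> //.
- rewrite divr_ge0 ?(ltW eps0)// mulr_ge0// sin_ge0_pi// mdist_ge0/=.
  by have := dx 0 eps (lexx 0) (ltW eps0) (lexx _); rewrite xi0; lra.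
- move=> s /andP[s0 se]; have [_ h1 h2] := coll s eps s0 se (lexx _).
  split=> //.
  + exact: rpos.
  + by rewrite -xi0; apply: dx.
  + apply: (mulfI (lt0r_neq0 eps0)).
    rewrite [RHS](_ : _ = eps * r0%:num
      + s * ((r eps)%:num * cos (mdist x0 (xi eps)) - r0%:num)).
      by rewrite -h1; ring.
    by field; rewrite gt_eqF.
  + by apply: (mulfI (lt0r_neq0 eps0)); rewrite h2; field; rewrite gt_eqF.
- by move=> s t s0 st te; have [] := coll s t s0 st te.
Qed.

(** The projection [xi] need not have constant speed, but distances along it are differences of the
    angle [th]. Parametrizing it by [th], through the inverse from [line_angle_inverse], yields a
    base geodesic. *)
Lemma cone_geodesic_line (x0 : X) (r0 : {nonneg R}) (y : R -> cone X) :
  0 < r0%:num -> nontrivial_geodesic_from (cone_pt x0 r0) y ->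
  exists c k (x : R -> X) (u : R -> R),
  [/\ 0 <= k, cone_line x0 r0%:num y c k x u &
    0 < k -> nontrivial_geodesic_from x0 x /\ homeo_at_0 u].
Proof.
move=> r00 yg; have [xi [r [c [k [eps [e0 k0 xi0 H D]]]]]] := cone_geodesic_polar r00 yg.
have pi0 := pi_gt0 R.
have [k_eq0|kn] := eqVneq k 0.
  exists c, k, xi, id; split=> //; last by rewrite k_eq0 ltxx.
  exists r, eps; split=> // s /andP[s0 se].
  by have [|? ? /ltW] := H s; first by rewrite !ltW.
have kp : 0 < k by rewrite lt_def kn.
pose th s := mdist x0 (xi s).
have [|sigma sigmaP] := @line_angle_inverse _ r0%:num c k eps (fun s => (r s)%:num) th r00 kp e0.
  by move=> s /H[_ rs ds cs ss]; rewrite /th mdist_ge0.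
have De s t : 0 <= s <= eps -> 0 <= t <= eps -> mdist (xi s) (xi t) = `|th s - th t|.
  move=> /andP[s0 se] /andP[t0 te]; rewrite /th; have [st|/ltW ts] := leP s t.
    by rewrite (D s t)// distrC addrC addKr ger0_norm// mdist_ge0.
  by rewrite (D t s)// addrC addKr ger0_norm ?mdist_ge0// metric_sym.
have th0 s : 0 < s <= eps -> 0 < th s.
  move=> /andP[s0 se]; have [|_ rs ds _ ss] := H s; first by rewrite ltW.
  rewrite lt_def mdist_ge0 andbT; apply/eqP => t0; move: ss.
  by rewrite -/(th s) t0 sin0 mulr0 => /esym/eqP; rewrite mulf_eq0 !gt_eqF.
have T0 : 0 < th eps by apply: th0; rewrite e0 lexx.
have th_mono s t : 0 <= s -> s <= t -> t <= eps -> th s <= th t.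
  by move=> s0 st te; rewrite /th (D s t)// lerDl mdist_ge0.
have sT (p : R) : 0 <= p <= 1 -> 0 <= p * th eps <= th eps.
  by case/andP=> p0 p1; rewrite mulr_ge0 ?(ltW T0)// ler_piMl// ltW.
(* The angle is normalized by its final value, so that [x] runs over [[0, 1]] and [u] recovers the
   parameter. *)
pose x p := xi (sigma (p * th eps)); pose u s := th s / th eps.
have xd p q : 0 <= p <= 1 -> 0 <= q <= 1 -> mdist (x p) (x q) = `|p - q| * th eps.
  move=> /sT/sigmaP[p1 _ p2] /sT/sigmaP[q1 _ q2].
  by rewrite /x De// p2 q2 -mulrBl normrM (gtr0_norm T0).
have x01 : mdist (x 0) (x 1) = th eps.
  by rewrite xd ?lexx ?ler01// sub0r normrN normr1 mul1r.
exists c, k, x, u; split=> // [|_].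
  exists r, eps; split=> // s /andP[s0 se].
  have s01 : 0 <= s <= eps by rewrite !ltW.
  have [|s1 _ s2] := sigmaP (th s); first by rewrite mdist_ge0 th_mono ?(ltW s0) ?(ltW se).
  have -> : x (u s) = xi s.
    apply: mdist_positivity; rewrite /x /u divfK ?gt_eqF//.
    by rewrite De// s2 subrr normr0.
  by have [ys rs /ltW] := H s s01.
split; first split.
- by move=> p q p01 q01; rewrite x01 xd.
- apply/esym/mdist_positivity; have [|s1 _ s2] := sigmaP 0; first by rewrite lexx ltW.
  by rewrite /x mul0r -/(th _) s2.
- by rewrite -mdist_gt0 x01.
apply: (@homeo_at_0_mono _ u (fun p => sigma (p * th eps)) eps 1) => //.
- by move=> s /th0 s0; rewrite divr_gt0.
- by move=> s t s0 st te; rewrite ler_pM2r ?invr_gt0// th_mono.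
- move=> p /andP[p0 p1]; have [|/andP[_ s1] s2 s3] := sigmaP (p * th eps).
    by rewrite sT// p1 ltW.
  by rewrite s1 s2 ?mulr_gt0// /u s3 mulfK ?gt_eqF.
Qed.

(** The lift is the tangent line to the unit circle at the starting point: at time [s] it has angle
    [atan (l s)] and radius [sqrt (1 + (l s)^2)], hence speed [l], the same as in the base. *)
Lemma cone_lift_line (x0 : X) (x : R -> X) : nontrivial_geodesic_from x0 x ->
  exists (y : R -> cone X) (u : R -> R),
  [/\ nontrivial_geodesic_from (cone_pt x0 1%:nng) y,
    cone_line x0 1 y 0 (mdist (x 0) (x 1)) x u, homeo_at_0 u &
    mdist (y 0) (y 1) = mdist (x 0) (x 1)].
Proof.
move=> xg; have [xG x00 _] := xg; have l0 := geodesic_length_gt0 xg.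
set l := mdist _ _ in l0 *; have pi0 := pi_gt0 R.
have atan0p s : 0 <= s -> 0 <= atan (l * s).
  by move=> s0; rewrite -atan0 le_atan// mulr_ge0// ltW.
pose u s := atan (l * s) / l.
have ul s : u s * l = atan (l * s) by rewrite divfK// gt_eqF.
(* As [atan (l s) <= l s <= l], the lift uses [x] only on [[0, 1]], where it is a geodesic. *)
have u01 s : 0 <= s <= 1 -> 0 <= u s <= 1.
  move=> /andP[s0 s1]; rewrite divr_ge0 ?atan0p ?(ltW l0)//= ler_pdivrMr// mul1r.
  by rewrite (le_trans (atan_le _))// ?mulr_ge0 ?ler_piMr// ltW.
pose rho s := Num.sqrt (1 + (l * s) ^+ 2).
have rho0 s : 0 < 1 + (l * s) ^+ 2 by rewrite ltr_pwDl// sqr_ge0.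
have rhop s : 0 < rho s by rewrite sqrtr_gt0.
have rho2 s : rho s ^+ 2 = 1 + (l * s) ^+ 2 by rewrite sqr_sqrtr// ltW.
have rhoc s : rho s * cos (atan (l * s)) = 1 by rewrite cos_atan mulfV// gt_eqF.
have rhos s : rho s * sin (atan (l * s)) = l * s.
  have c0 : cos (atan (l * s)) != 0.
    by apply/eqP => c0; have := rhoc s; rewrite c0 mulr0 => /eqP; rewrite eq_sym oner_eq0.
  have := atanK (l * s); rewrite /tan => /(congr1 ( *%R^~ (cos (atan (l * s))))).
  by rewrite divfK// => ->; rewrite mulrCA rhoc mulr1.
pose y s := cone_pt (x (u s)) (NngNum (ltW (rhop s))).
have yd s t : 0 <= s <= 1 -> 0 <= t <= 1 -> mdist (y s) (y t) = `|s - t| * l.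
  move=> s01 t01; apply/eqP; rewrite -(@eqrXn2 _ 2) ?mdist_ge0 ?mulr_ge0 ?(ltW l0)//.
  rewrite cone_mdistE xG ?u01// -/l -(gtr0_norm l0) -normrM mulrBl !ul min_r; last first.
    case/andP: s01 => s0 _; case/andP: t01 => t0 _.
    have := atan_ltpi2 (l * s); have := atan_ltpi2 (l * t).
    have := atan0p s s0; have := atan0p t t0.
    by move=> *; rewrite ler_norml; apply/andP; split; lra.
  rewrite cos_norm cosB/= exprMn !real_normK ?num_real//.
  rewrite (_ : _ - _ = rho s ^+ 2 + rho t ^+ 2 - 2 *
      (rho s * cos (atan (l * s)) * (rho t * cos (atan (l * t)))
     + rho s * sin (atan (l * s)) * (rho t * sin (atan (l * t))))); last by ring.
  by rewrite !rhoc !rhos !rho2; apply/eqP; ring.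
have y01 : mdist (y 0) (y 1) = l.
  by rewrite yd ?lexx ?ler01// sub0r normrN normr1 mul1r.
exists y, u; split=> //.
- split; [by move=> s t s01 t01; rewrite y01 yd| |by rewrite -mdist_gt0 y01].
  rewrite /y /u mulr0 atan0 mul0r x00; congr cone_pt; apply: val_inj => /=.
  by rewrite /rho mulr0 expr0n addr0 sqrtr1.
- exists (fun s => NngNum (ltW (rhop s))), 1; split=> // s /andP[s0 s1].
  have s01 : 0 <= s <= 1 by rewrite !ltW.
  rewrite (mdist_geodesic_start xg (u01 s s01)) -/l ul mul0r addr0; split=> //.
  + exact: rhop.
  + exact/ltW/atan_ltpi2.
  + exact: rhoc.
  + exact: rhos.
have u10 : 0 < u 1 by rewrite divr_gt0// mulr1 -atan0 lt_atan.
apply: (@homeo_at_0_mono _ u (fun p => tan (p * l) / l) 1 (u 1)) => //.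
- by move=> s /andP[s0 _]; rewrite divr_gt0// -atan0 lt_atan// mulr_gt0.
- by move=> s t _ st _; rewrite ler_pM2r ?invr_gt0// le_atan// ler_pM2l.
- move=> p /andP[p0 p1].
  have pl0 : 0 < p * l by rewrite mulr_gt0.
  have pl1 : p * l <= atan l by rewrite -{2}(mulr1 l) -ul ler_pM2r.
  have tK : atan (tan (p * l)) = p * l.
    by rewrite tanK// in_itv/=; have := atan_ltpi2 l; move=> ?; apply/andP; split; lra.
  split; last by rewrite /u mulrCA mulfV ?gt_eqF// mulr1 tK mulfK// gt_eqF.
  apply/andP; split.
    rewrite divr_gt0// ltNge; apply/negP => /le_atan; rewrite tK atan0; lra.
  rewrite ler_pdivrMr// mul1r leNgt; apply/negP => /lt_atan; rewrite tK; lra.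
Qed.

End ConeGeodesics.

(** * Transfer of the angle condition between base and cone; its form at the apex *)

Section LocalAngleCondition.
Context {R : realType}.

(** Perturb the weights to [b i + e] and let [e] tend to 0. Zero weights arise in the cone from
    geodesics with a radial direction. *)
Lemma LAC_at_nonneg_weights (Y : metricType R) (m : nat) (y0 : Y)
    (y : 'I_m -> R -> Y) (b : 'I_m -> R) :
  LAC_at m y0 -> (forall i, nontrivial_geodesic_from y0 (y i)) ->
  (forall i, 0 <= b i) ->
  0 <= \sum_(i < m) \sum_(j < m) b i * b j * cos (upper_angle y0 (y i) (y j)).
Proof.
move=> H yg b0; pose K i j := cos (upper_angle y0 (y i) (y j)).
pose A := \sum_(i < m) \sum_(j < m) b i * b j * K i j.
pose B := \sum_(i < m) \sum_(j < m) (b i + b j) * K i j.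
pose C := \sum_(i < m) \sum_(j < m) K i j.
have P e : 0 < e -> 0 <= A + e * B + e ^+ 2 * C.
  move=> e0; have := H y (fun i => b i + e) yg (fun i => ltr_wpDl (b0 i) e0).
  rewrite /A /B /C !mulr_sumr -!big_split/=; congr (0 <= _).
  apply: eq_bigr => i _; rewrite !mulr_sumr -!big_split/=.
  by apply: eq_bigr => j _; rewrite -/(K i j); ring.
rewrite -/A leNgt; apply/negP => A0.
pose M := `|B| + `|C| + 1.
have M0 : 0 < M by rewrite ltr_wpDl// addr_ge0.
(* With this [e] the perturbation is at most [e (|B| + |C|) < e M <= - A / 2], too small to
   compensate a negative [A]. *)
pose e := Num.min 1 (- A / (2 * M)).
have e0 : 0 < e by rewrite lt_min ltr01 divr_gt0 ?mulr_gt0// oppr_gt0.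
have e1 : e <= 1 by rewrite ge_min lexx.
have eM : e * (2 * M) <= - A.
  by rewrite -ler_pdivlMr ?mulr_gt0// ge_min lexx orbT.
have h1 : e * B <= e * `|B| by rewrite ler_pM2l// ler_norm.
have h2 : e ^+ 2 * C <= e * `|C|.
  rewrite expr2 -mulrA ler_pM2l// (le_trans (ler_norm _))// normrM gtr0_norm//.
  by rewrite ler_piMl.
have := P e e0; rewrite /M in eM; lra.
Qed.

Context {X : metricType R}.

(** Tangential lifts have [c = 0] and [k] equal to their speed, so the two sums agree term by
    term. *)
Lemma LAC_at_base (m : nat) (x0 : X) :
  LAC_at m (cone_pt x0 1%:nng) -> LAC_at m x0.
Proof.
move=> H x b xg b0.
have /choice[y Hy] i := cone_lift_line (xg i).
have /choice[u Hu] := Hy.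
have := H y b; set S := \sum_i _; set T := \sum_i _.
suff -> : S = T by apply => // i; case: (Hu i).
apply: eq_bigr => i _; apply: eq_bigr => j _; congr (_ * _).
have [gi li ui ei] := Hu i; have [gj lj uj ej] := Hu j.
rewrite (upper_angle_cone_line (r0 := 1%:nng) gi gj li lj) ?mdist_ge0// ei ej mul0r add0r.
by rewrite mulrAC mulfV ?mul1r// mulf_neq0// gt_eqF// (geodesic_length_gt0 (xg _)).
Qed.

Lemma LAC_at_cone (m : nat) (x0 : X) (r0 : {nonneg R}) :
  0 < r0%:num -> LAC_at m x0 -> LAC_at m (cone_pt x0 r0).
Proof.
move=> r00 H y b yg b0.
have /choice[c Hc] i := cone_geodesic_line r00 (yg i).
have /choice[k Hk] := Hc; have /choice[x Hx] := Hk; have /choice[u Hu] := Hx.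
pose v i := mdist (y i 0) (y i 1).
have v0 i : 0 < v i := geodesic_length_gt0 (yg i).
have k0 i : 0 <= k i by case: (Hu i).
pose K i j := cos (upper_angle x0 (x i) (x j)).
have -> : \sum_(i < m) \sum_(j < m) b i * b j *
      cos (upper_angle (cone_pt x0 r0) (y i) (y j))
    = (\sum_(i < m) b i * c i / v i) ^+ 2
      + \sum_(i < m) \sum_(j < m) (b i * k i / v i) * (b j * k j / v j) * K i j.
  rewrite expr2 big_distrlr/= -big_split/=; apply: eq_bigr => i _.
  rewrite -big_split/=; apply: eq_bigr => j _.
  have [_ li gi] := Hu i; have [_ lj gj] := Hu j.
  rewrite (upper_angle_cone_line (yg i) (yg j) li lj)// -/(v i) -/(v j) -/(K i j).
  by field; rewrite !gt_eqF.
rewrite addr_ge0 ?sqr_ge0//.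
have [[i0 ki0]|kz] := pselect (exists i0, 0 < k i0); last first.
  rewrite big1// => i _; rewrite big1// => j _.
  suff -> : k i = 0 by rewrite mulr0 !mul0r.
  by apply/eqP/negPn/negP => ki; apply: kz; exists i; rewrite lt_def ki k0.
(* Radial indices carry weight 0 but still need a nontrivial base geodesic; the one of [i0] stands
   in. *)
pose x' i := if 0 < k i then x i else x i0.
have x'g i : nontrivial_geodesic_from x0 (x' i).
  by rewrite /x'; case: ifP => [ki|_]; [have [_ _ []] := Hu i|have [_ _ []] := Hu i0].
have b'0 i : 0 <= b i * k i / v i by rewrite divr_ge0 ?mulr_ge0 ?(ltW (b0 i)) ?(ltW (v0 i)).
have := LAC_at_nonneg_weights H x'g b'0; congr (0 <= _).
apply: eq_bigr => i _; apply: eq_bigr => j _; rewrite /K /x'.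
have kz l : ~~ (0 < k l) -> k l = 0 by rewrite -leNgt => kl; apply/le_anti; rewrite kl k0.
case: ifPn => [_|/kz->]; last by rewrite mulr0 !mul0r.
by case: ifPn => [_|/kz->]; last by rewrite !(mulr0, mul0r).
Qed.

(** The radius at [s] is the distance [s v] from the apex; the law of cosines between [y s] and
    [y 1] then forces the cosine of their truncated distance to be 1, so both lie over the same base
    point. *)
Lemma apex_geodesic (x0 : X) (o : {nonneg R}) (y : R -> cone X) :
  o%:num = 0 -> nontrivial_geodesic_from (cone_pt x0 o) y ->
  exists x : X, forall s, 0 < s <= 1 ->
    exists2 r : {nonneg R}, y s = cone_pt x r & r%:num = s * mdist (y 0) (y 1).
Proof.
move=> o0 yg; have [yG _ _] := yg; have v0 := geodesic_length_gt0 yg.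
set v := mdist _ _ in v0 *.
have radius s : 0 <= s <= 1 -> forall x r, y s = cone_pt x r -> r%:num = s * v.
  move=> s01 x r ys; have := cone_mdistE x0 x o r.
  rewrite -ys (mdist_geodesic_start yg s01) -/v o0 expr0n/= add0r mulr0 !mul0r subr0.
  move=> /eqP; rewrite eqrXn2 ?mulr_ge0 ?(ltW v0)//; first by move/eqP => ->.
  by case/andP: s01.
have [x1 [r1 y1]] := cone_ptP (y 1); exists x1 => s /andP[s0 s1].
have s01 : 0 <= s <= 1 by rewrite ltW.
have i1 : 0 <= (1 : R) <= 1 by rewrite ler01 lexx.
have [x [r ys]] := cone_ptP (y s); have rs := radius s s01 x r ys.
exists r => //; rewrite ys; congr cone_pt.
have := cone_mdistE x x1 r r1; rewrite -ys -y1 yG// rs (radius 1 i1 x1 r1 y1) -/v mul1r.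
rewrite exprMn real_normK ?num_real// => E.
have c1 : cos (Num.min pi (mdist x x1)) = 1.
  have n0 : 2 * s * v ^+ 2 != 0 by rewrite gt_eqF// !mulr_gt0// exprn_gt0.
  by apply: (mulfI n0); lra.
have m0 : Num.min pi (mdist x x1) = 0.
  apply: cos_inj; rewrite ?cos0// in_itv /= ?lexx ?pi_ge0//.
  by rewrite le_min pi_ge0 mdist_ge0 ge_min lexx.
apply: mdist_positivity; move: m0; rewrite /Num.min; case: ifP => // _ p0.
by have := pi_gt0 R; rewrite p0 ltxx.
Qed.

(** By the law of cosines the comparison cosine of two rays does not depend on the parameters, so
    the lower limit is that of a constant. *)
Lemma upper_angle_apex (x0 x1 x2 : X) (o : {nonneg R}) (y1 y2 : R -> cone X) :
  nontrivial_geodesic_from (cone_pt x0 o) y1 ->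
  nontrivial_geodesic_from (cone_pt x0 o) y2 ->
  (forall s, 0 < s <= 1 -> exists2 r : {nonneg R}, y1 s = cone_pt x1 r &
     r%:num = s * mdist (y1 0) (y1 1)) ->
  (forall s, 0 < s <= 1 -> exists2 r : {nonneg R}, y2 s = cone_pt x2 r &
     r%:num = s * mdist (y2 0) (y2 1)) ->
  cos (upper_angle (cone_pt x0 o) y1 y2) = cos (Num.min pi (mdist x1 x2)).
Proof.
move=> g1 g2 H1 H2; apply: (liminf2_unique (liminf2_upper_angle g1 g2)).
have v10 := geodesic_length_gt0 g1; have v20 := geodesic_length_gt0 g2.
apply: (liminf2_eventually_const ltr01) => s t /andP[s0 /ltW s1] /andP[t0 /ltW t1].
have [|r ys rs] := H1 s; first by rewrite s0.
have [|r' yt rt] := H2 t; first by rewrite t0.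
rewrite /comparison_cos.
rewrite (mdist_geodesic_start g1) ?(ltW s0)// (mdist_geodesic_start g2) ?(ltW t0)//.
by rewrite ys yt cone_mdistE rs rt; field; rewrite !gt_eqF.
Qed.

Definition apex_form m (x : 'I_m -> X) (b : 'I_m -> R) :=
  \sum_(i < m) \sum_(j < m) b i * b j * cos (Num.min pi (mdist (x i) (x j))).

Lemma LAC_at_apex m (x0 : X) (o : {nonneg R}) : o%:num = 0 ->
  LAC_at m (cone_pt x0 o) <->
  forall (x : 'I_m -> X) (b : 'I_m -> R), (forall i, 0 < b i) -> 0 <= apex_form x b.
Proof.
move=> o0; split=> [H x b b0|H y b yg b0]; last first.
  have /choice[x Hx] i := apex_geodesic o0 (yg i).
  have := H x b b0; congr (0 <= _); apply: eq_bigr => i _; apply: eq_bigr => j _.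
  by rewrite (upper_angle_apex (yg i) (yg j) (Hx i) (Hx j)).
(* On [[0, 1]] this is the unit-speed ray over [x i]; the absolute value only provides a radius for
   negative [s]. *)
pose y (i : 'I_m) (s : R) := cone_pt (x i) (NngNum (normr_ge0 s)).
have pi0 := pi_gt0 R.
have yd i s t : 0 <= s <= 1 -> 0 <= t <= 1 -> mdist (y i s) (y i t) = `|s - t|.
  move=> /andP[s0 _] /andP[t0 _]; apply/eqP; rewrite -(@eqrXn2 _ 2) ?mdist_ge0//.
  rewrite cone_mdistE mdistxx min_r ?(ltW pi0)// cos0/= (ger0_norm s0) (ger0_norm t0).
  by rewrite real_normK ?num_real//; apply/eqP; ring.
have y01 i : mdist (y i 0) (y i 1) = 1.
  by rewrite yd ?lexx ?ler01// sub0r normrN normr1.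
have yg i : nontrivial_geodesic_from (cone_pt x0 o) (y i).
  split; [by move=> s t s0 t0; rewrite y01 mulr1 yd| |by rewrite -mdist_gt0 y01].
  rewrite /y; apply: mdist_positivity; apply/eqP; rewrite -sqrf_eq0 cone_mdistE/=.
  by rewrite o0 normr0 expr0n/= !(mulr0, mul0r, addr0, subr0).
have yr i s : 0 < s <= 1 -> exists2 r : {nonneg R}, y i s = cone_pt (x i) r &
     r%:num = s * mdist (y i 0) (y i 1).
  by move=> /andP[s0 _]; exists (NngNum (normr_ge0 s)) => //=; rewrite y01 mulr1 gtr0_norm.
have := H y b yg b0; congr (0 <= _); apply: eq_bigr => i _; apply: eq_bigr => j _.
by rewrite (upper_angle_apex (yg i) (yg j) (yr i) (yr j)).
Qed.

End LocalAngleCondition.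

(** * The quadratic form at the apex for three points, and for small diameter *)

Section ThreePoints.
Context {R : realType}.
Implicit Types (a b c : R).

(** The squared length of a combination of three unit vectors with these pairwise angles, whenever
    such vectors exist. *)
Definition form3 a b c (p q r : R) :=
  p ^+ 2 + q ^+ 2 + r ^+ 2
  + 2 * (p * q * cos a + q * r * cos b + r * p * cos c).

(** Take planar unit vectors at angle [a] on one side and [b] on the other side of the vector
    weighted by [q]. The outer two have inner product [cos (a + b)], which is at most [cos c] by the
    triangle or the perimeter bound, so the form dominates a squared length. *)
Lemma form3_ge0 a b c (p q r : R) : 0 <= a -> 0 <= b -> 0 <= c ->
  c <= a + b -> a + b + c <= 2 * pi -> 0 <= p -> 0 <= r -> 0 <= form3 a b c p q r.
Proof.
move=> a0 b0 c0 cab abc p0 r0.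
have cos_c : cos (a + b) <= cos c.
  have [abpi|piab] := leP (a + b) pi; first exact: cos_le.
  have -> : cos (a + b) = cos (2 * pi - (a + b)).
    by rewrite -cosN -(cosD2pi (- (a + b))); congr cos; rewrite mulr2n; ring.
  by apply: cos_le; lra.
have rp : 0 <= r * p by rewrite mulr_ge0.
have h : r * p * cos (a + b) <= r * p * cos c by rewrite ler_wpM2l.
have : 0 <= (q + p * cos a + r * cos b) ^+ 2 + (p * sin a - r * sin b) ^+ 2.
  by rewrite addr_ge0 ?sqr_ge0.
have -> : (q + p * cos a + r * cos b) ^+ 2 + (p * sin a - r * sin b) ^+ 2
   = p ^+ 2 * (cos a ^+ 2 + sin a ^+ 2) + q ^+ 2 + r ^+ 2 * (cos b ^+ 2 + sin b ^+ 2)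
     + 2 * (p * q * cos a + q * r * cos b + r * p * cos (a + b)).
  by rewrite cosD; ring.
by rewrite !cos2Dsin2 !mulr1 /form3; lra.
Qed.

(** At [p = q = 1] the opposite vectors cancel and [r^2 + 2 r (cos b + cos c)] remains; it is
    negative at [r = - (cos b + cos c)], which is positive if [b + c > pi]. *)
Lemma form3_pi b c : (forall p q r, 0 < p -> 0 < q -> 0 < r -> 0 <= form3 pi b c p q r) ->
  0 <= b <= pi -> 0 <= c <= pi -> b + c <= pi.
Proof.
move=> H b0 c0; suff : b <= pi - c by lra.
apply: cos_le_inv; [lra|lra|].
rewrite addrC cosDpi cosN -subr_ge0 opprK leNgt; apply/negP => bc.
have e0 : 0 < - (cos b + cos c) by lra.
have := H 1 1 _ ltr01 ltr01 e0; rewrite /form3 cospi; set e := - (_ + _) in e0 *.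
have -> : cos b = - e - cos c by rewrite /e; ring.
suff : 0 < e ^+ 2 by move=> *; lra.
by rewrite exprn_gt0.
Qed.

(* If the perimeter exceeded [2 pi], unit vectors in the plane with consecutive
   angles [a], [b] and [2 pi - a - b < c] would be in equilibrium under positive weights
   (the sines of the opposite angles), making the form negative at these weights. *)
Lemma form3_perimeter a b c : 0 < a < pi -> 0 < b < pi -> 0 < c < pi ->
  (forall p q r, 0 < p -> 0 < q -> 0 < r -> 0 <= form3 a b c p q r) ->
  a + b + c <= 2 * pi.
Proof.
move=> /andP[a0 api] /andP[b0 bpi] /andP[c0 cpi] H; rewrite leNgt; apply/negP => abc.
pose d := 2 * pi - (a + b).
have sa : 0 < sin a by rewrite sin_gt0_pi// a0.
have sb : 0 < sin b by rewrite sin_gt0_pi// b0.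
have sd : 0 < sin d by rewrite sin_gt0_pi// /d; lra.
have cd : cos c < cos d by apply: cos_lt; rewrite /d; lra.
have dE : d = - (a + b) + pi *+ 2 by rewrite /d mulr2n; ring.
have sdE : sin d = - (sin a * cos b + cos a * sin b) by rewrite dE sinD2pi sinN sinD.
have cdE : cos d = cos a * cos b - sin a * sin b by rewrite dE cosD2pi cosN cosD.
have := H _ _ _ sb sd sa; rewrite leNgt => /negP; apply.
have : form3 a b d (sin b) (sin d) (sin a) = 0.
  rewrite /form3 sdE cdE.
  transitivity (sin b ^+ 2 * (1 - (cos a ^+ 2 + sin a ^+ 2))
    + sin a ^+ 2 * (1 - (cos b ^+ 2 + sin b ^+ 2))); first by ring.
  by rewrite !cos2Dsin2; ring.
have : sin a * sin b * cos c < sin a * sin b * cos d by rewrite ltr_pM2l// mulr_gt0.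
rewrite /form3; lra.
Qed.

Context {X : metricType R}.

Lemma apex_form3 (x : 'I_3 -> X) (p : 'I_3 -> R) :
  let i : 'I_3 := inord 0 in let j : 'I_3 := inord 1 in let k : 'I_3 := inord 2 in
  apex_form x p = form3 (Num.min pi (mdist (x i) (x j))) (Num.min pi (mdist (x j) (x k)))
    (Num.min pi (mdist (x k) (x i))) (p i) (p j) (p k).
Proof.
move=> i j k; rewrite /apex_form !big_ord_recr !big_ord0 /=.
have -> : widen_ord (leqnSn 2) (widen_ord (leqnSn 1) ord_max) = i.
  by apply: val_inj; rewrite /= inordK.
have -> : widen_ord (leqnSn 2) ord_max = j by apply: val_inj; rewrite /= inordK.
have -> : ord_max = k by apply: val_inj; rewrite /= inordK.
rewrite !mdistxx min_r ?pi_ge0// cos0 (metric_sym (x j) (x i)) (metric_sym (x k) (x j)).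
by rewrite (metric_sym (x i) (x k)) /form3; ring.
Qed.

Lemma apex_perimeter_le (x0 x1 x2 : X) (o : {nonneg R}) : o%:num = 0 ->
  LAC_at 3 (cone_pt x0 o) -> x0 != x1 -> x1 != x2 -> x2 != x0 ->
  mdist x0 x1 + mdist x1 x2 + mdist x2 x0 <= 2 * pi.
Proof.
move=> o0 /(LAC_at_apex _ _ o0) H; have pi0 := pi_gt0 R.
have F (z0 z1 z2 : X) p q r : 0 < p -> 0 < q -> 0 < r -> 0 <= form3
    (Num.min pi (mdist z0 z1)) (Num.min pi (mdist z1 z2)) (Num.min pi (mdist z2 z0)) p q r.
  move=> p0 q0 r0; have := H (tnth [tuple z0; z1; z2]) (tnth [tuple p; q; r]).
  rewrite apex_form3 !(tnth_nth z0) !(tnth_nth p) !inordK//=; apply.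
  by move=> i; rewrite (tnth_nth p); case: i => [[|[|[|]]]].
(* A distance of at least [pi] is truncated to [pi]; then [form3_pi] bounds the sum of the other two
   by [pi], and the triangle inequality brings the first one down to [pi] as well. *)
have far (z0 z1 z2 : X) : z0 != z1 -> z1 != z2 -> z2 != z0 -> pi <= mdist z0 z1 ->
    mdist z0 z1 + mdist z1 z2 + mdist z2 z0 <= 2 * pi.
  rewrite -!mdist_gt0 => d01 d12 d20 pid.
  have := F z0 z1 z2; rewrite (min_l pid) => /form3_pi.
  rewrite !le_min !ge_min !lexx !mdist_ge0 (ltW pi0)/= => /(_ isT isT).
  have := metric_triangle z0 z2 z1; rewrite (metric_sym z0 z2) (metric_sym z2 z1).
  by case: (leP pi (mdist z1 z2)) => ?; case: (leP pi (mdist z2 z0)) => ?; lra.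
move=> n01 n12 n20.
have [/far|d01] := leP pi (mdist x0 x1); first exact.
have [/(far x1 x2 x0 n12 n20 n01)|d12] := leP pi (mdist x1 x2); first lra.
have [/(far x2 x0 x1 n20 n01 n12)|d20] := leP pi (mdist x2 x0); first lra.
have := F x0 x1 x2; rewrite !min_r ?(ltW d01) ?(ltW d12) ?(ltW d20)//.
by apply: form3_perimeter; rewrite mdist_gt0 ?n01 ?n12 ?n20.
Qed.

Lemma LAC3_apex (x0 : X) (o : {nonneg R}) : o%:num = 0 ->
  perimeter_le_2pi X -> LAC_at 3 (cone_pt x0 o).
Proof.
move=> o0 per; apply/(LAC_at_apex _ _ o0) => x b b0; rewrite apex_form3.
set z0 := x (inord 0); set z1 := x (inord 1); set z2 := x (inord 2).
have pi0 := pi_gt0 R.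
have cap (z w : X) : Num.min pi (mdist z w) <= pi /\ Num.min pi (mdist z w) <= mdist z w.
  by rewrite !ge_min !lexx orbT.
have cap0 (z w : X) : 0 <= Num.min pi (mdist z w) by rewrite le_min (ltW pi0) mdist_ge0.
apply: form3_ge0; rewrite ?cap0 ?(ltW (b0 _))//.
  have := metric_triangle z2 z1 z0; rewrite (metric_sym z2 z1) (metric_sym z1 z0).
  have := mdist_ge0 z0 z1; have := mdist_ge0 z1 z2.
  case: (leP pi (mdist z0 z1)) => ?; case: (leP pi (mdist z1 z2)) => ?;
    case: (leP pi (mdist z2 z0)) => ?; lra.
have [c1 c1'] := cap z0 z1; have [c2 c2'] := cap z1 z2; have [c3 c3'] := cap z2 z0.
(* The perimeter bound concerns distinct points; if two coincide, one truncated distance is 0 and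
   the others are at most [pi]. *)
have [e01|n01] := eqVneq z0 z1; first by have := mdistxx z1; rewrite -{1}e01; lra.
have [e12|n12] := eqVneq z1 z2; first by have := mdistxx z2; rewrite -{1}e12; lra.
have [e20|n20] := eqVneq z2 z0; first by have := mdistxx z0; rewrite -{1}e20; lra.
have := per z0 z1 z2 n01 n12 n20; lra.
Qed.

Lemma LAC_apex_small_diameter (m : nat) (x0 : X) (o : {nonneg R}) : o%:num = 0 ->
  (diameter X <= (pi / 2)%:E)%E -> LAC_at m (cone_pt x0 o).
Proof.
move=> o0 diam; apply/(LAC_at_apex _ _ o0) => x b b0; have pi0 := pi_gt0 R.
apply: sumr_ge0 => i _; apply: sumr_ge0 => j _; apply: mulr_ge0.
  by rewrite mulr_ge0// ltW.
have dij : mdist (x i) (x j) <= pi / 2.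
  by rewrite -lee_fin (le_trans _ diam)//; apply: ereal_sup_ubound; exists (x i, x j).
rewrite min_r; last by lra.
by have := mdist_ge0 (x i) (x j) => ?; apply: cos_ge0_pihalf; apply/andP; split; lra.
Qed.

End ThreePoints.

(** * Assembly of the four claims, separating the apex from the other points *)

Theorem corollary2p21 (R : realType) (X : metricType R)
    (hX : geodesic_space X) (m : nat) :
  [/\ (* (a) *) LAC m (cone X) -> LAC m X,
      (* (b) *) LAC m X -> forall p : cone X, ~ apex X p -> LAC_at m p,
      (* (c) *) LAC 3 (cone X) <-> LAC 3 X /\ perimeter_le_2pi X
    & (* (d) *) (diameter X <= (pi / 2)%:E)%E -> LAC m X -> LAC m (cone X)].
Proof.
have base n : LAC n (cone X) -> LAC n X by move=> H x; exact/LAC_at_base/H.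
have off_apex n : LAC n X ->
    (forall (x : X) (o : {nonneg R}), o%:num = 0 -> LAC_at n (cone_pt x o)) ->
    LAC n (cone X).
  move=> H Ha p; have [x [r ->]] := cone_ptP p.
  have [/Ha//|r0] := eqVneq r%:num 0; apply: LAC_at_cone => //.
  by rewrite lt_def r0 /=.
split.
- exact: base.
- move=> H p; have [x [r ->]] := cone_ptP p; have [r0 /= []|r0 _] := eqVneq r%:num 0.
    by exists x; congr cone_pt; apply: val_inj.
  by apply: LAC_at_cone => //; rewrite lt_def r0 /=.
- split=> [H|[H per]]; last by apply: off_apex => // x o o0; exact: LAC3_apex.
  split; first exact: base.
  by move=> x1 x2 x3; apply: (@apex_perimeter_le _ _ _ _ _ 0%:nng) => //; exact: H.
- by move=> diam H; apply: off_apex => // x o o0; exact: LAC_apex_small_diameter.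
Qed.
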